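(* Let $\mu\in(0,1)$, let $p_1<p_2$ be real numbers, and let $u_0$ be a tempered distribution on $\mathbb{R}$ satisfying Condition $(C_{[p_1,p_2],\mu})$. Let $u$ be the solution of the free Schrödinger equation with initial datum $u_0$. Fix $\varepsilon\in(0,\frac12)$ and let $$\mathfrak{R}_\varepsilon(p_1,p_2):=\left\{(t,x)\in(0,+\infty)\times\mathbb{R}\;\middle|\;2p_1+2t^{-\varepsilon}\le\tfrac xt<2p_2,\ t>(p_2-p_1)^{-\frac1\varepsilon}\right\}.$$ Let $\delta\in(\frac12,1)$ satisfy $\delta>\frac12+\varepsilon$ and $\delta\ge\frac{\mu+1}2$, put $\gamma:=2\delta-1$, and let the exponents $\tilde\alpha_k^{(i)},\tilde\beta_k^{(i)}$ be those listed in the context. Then there exist constants $C_k^{(i)}(u_0)\ge0$, depending only on $u_0$ and $\delta$, such that for all $(t,x)\in\mathfrak{R}_\varepsilon(p_1,p_2)$: (1) if $\mu>\frac12$, $$|u(t,x)|\le C_0^{(1)}(u_0)\,t^{-\frac12+\varepsilon(1-\mu)}+\sum_{k=1}^9C_k^{(1)}(u_0)\,t^{-\tilde\beta_k^{(1)}+\varepsilon\tilde\alpha_k^{(1)}},$$ where $\max_{1\le k\le9}\{-\tilde\beta_k^{(1)}+\varepsilon\tilde\alpha_k^{(1)}\}<-\frac12+\varepsilon(1-\mu)$; (2) if $\mu=\frac12$, $$|u(t,x)|\le C_0^{(2)}(u_0)\,t^{-\frac12+\frac\varepsilon2}+\sum_{k=1}^8C_k^{(2)}(u_0)\,t^{-\tilde\beta_k^{(2)}+\varepsilon\tilde\alpha_k^{(2)}},$$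 where $\max_{1\le k\le8}\{-\tilde\beta_k^{(2)}+\varepsilon\tilde\alpha_k^{(2)}\}<-\frac12+\frac\varepsilon2$; (3) if $\mu<\frac12$, $$|u(t,x)|\le C_0^{(3)}(u_0)\,t^{-\mu+\varepsilon\mu}+\sum_{k=1}^9C_k^{(3)}(u_0)\,t^{-\tilde\beta_k^{(3)}+\varepsilon\tilde\alpha_k^{(3)}},$$ where $\max_{1\le k\le9}\{-\tilde\beta_k^{(3)}+\varepsilon\tilde\alpha_k^{(3)}\}<-\mu+\varepsilon\mu$. Moreover, in each case the decay rate $t^{-r}$, with $-r=-\frac12+\varepsilon(1-\mu)$, $-\frac12+\frac\varepsilon2$, $-\mu+\varepsilon\mu$ respectively, is optimal, in the sense that it is attained on the left boundary of the region: there exist $c>0$ and $T>0$ such that $|u(t,x)|\ge c\,t^{-r}$ for all $t\ge T$ and $x=2p_1t+2t^{1-\varepsilon}$.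
   Context: Fourier transform: $\mathcal{F}v(p)=\int_{\mathbb{R}}v(x)e^{-ixp}\,dx$, extended to tempered distributions. Condition $(C_{[p_1,p_2],\mu})$: $\mathcal{F}u_0$ is a function vanishing on $\mathbb{R}\setminus[p_1,p_2]$, and $\mathcal{F}u_0(p)=(p-p_1)^{\mu-1}\tilde u(p)$ for $p\in(p_1,p_2)$, where $\tilde u\in\mathcal{C}^1([p_1,p_2],\mathbb{C})$, $\tilde u(p_1)\ne0$ and $\tilde u(p_2)=0$ (i.e. $\mathcal{F}u_0(p_2)=0$). The solution of $[i\partial_t+\partial_x^2]u=0$, $u(0)=u_0$, is $u(t)=\mathcal{F}^{-1}(e^{-itp^2}\mathcal{F}u_0)$, that is, for $t>0$, $x\in\mathbb{R}$, $$u(t,x)=\frac1{2\pi}\int_{p_1}^{p_2}\mathcal{F}u_0(p)\,e^{-itp^2+ixp}\,dp .$$ Exponents: $(\tilde\alpha_k^{(1)})_{k=1}^9=(\mu,\,2-\mu,\,1-\mu,\,4-\mu,\,1+\gamma-\mu,\,\gamma-\mu,\,3-\mu,\,2-\mu,\,1-\mu)$, $(\tilde\beta_k^{(1)})_{k=1}^9=(\mu,1,1,2,\delta,\delta,\frac32,\delta,\delta)$; $(\tilde\alpha_k^{(2)})_{k=1}^8=(2-\mu,\,1-\mu,\,4-\mu,\,1+\gamma-\mu,\,\gamma-\mu,\,3-\mu,\,2-\mu,\,1-\mu)$, $(\tilde\beta_k^{(2)})_{k=1}^8=(1,1,2,\delta,\delta,\frac32,\delta,\delta)$; $(\tilde\alpha_k^{(3)})_{k=1}^9=(1-\mu,\,2-\mu,\,1-\mu,\,4-\mu,\,1+\gamma-\mu,\,\gamma-\mu,\,3-\mu,\,2-\mu,\,1-\mu)$,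 $(\tilde\beta_k^{(3)})_{k=1}^9=(\frac12,1,1,2,\delta,\delta,\frac32,\delta,\delta)$. *)

(* Defs.v *)
From Stdlib Require Export Reals RList List.
From Coquelicot Require Export Coquelicot.
Export ListNotations.
Open Scope R_scope.

(* Complex-valued functions of a real variable are differentiated and
   integrated in [C] seen as a two-dimensional real normed module, i.e.
   componentwise. *)

Definition expi (theta : R) : C := (cos theta, sin theta).

Definition Cderive_n (phi : R -> C) (n : nat) (x : R) : C :=
  (Derive_n (fun y => fst (phi y)) n x, Derive_n (fun y => snd (phi y)) n x).

Definition smooth (phi : R -> C) : Prop :=
  forall (n : nat) (x : R),
    ex_derive_n (fun y => fst (phi y)) n x /\
    ex_derive_n (fun y => snd (phi y)) n x.

Definition schwartz (phi : R -> C) : Prop :=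
  smooth phi /\
  forall j k : nat, exists M : R,
    forall x : R, Rabs x ^ j * Cmod (Cderive_n phi k x) <= M.

(* Only the values on Schwartz functions are meaningful.  Continuity is with
   respect to the Frechet topology of the Schwartz space: domination by
   finitely many of the seminorms sup_x |x|^j |phi^(k)(x)|. *)
Record tempered_distribution := TemperedDistribution {
  pairing :> (R -> C) -> C;
  pairing_linear : forall (a b : C) (phi psi : R -> C),
    schwartz phi -> schwartz psi ->
    pairing (fun x => a * phi x + b * psi x)%C
    = (a * pairing phi + b * pairing psi)%C;
  pairing_continuous : exists (N : nat) (M : R),
    forall phi : R -> C, schwartz phi ->
    forall B : R,
      (forall j k : nat, (j <= N)%nat -> (k <= N)%nat ->
       forall x : R, Rabs x ^ j * Cmod (Cderive_n phi k x) <= B) ->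
      Cmod (pairing phi) <= M * B
}.

Definition fourier (v : R -> C) (p : R) : C :=
  RInt_gen (V := C_R_CompleteNormedModule)
    (fun x => v x * expi (- (x * p)))%C
    (Rbar_locally m_infty) (Rbar_locally p_infty).

(* The Fourier transform of [u0], defined by duality
   <F u0, phi> = <u0, F phi>, is the function [f], which vanishes outside
   [p1, p2].  The integral of [f * phi] over [p1, p2] is improper at the
   endpoints because [f] may be unbounded there. *)
Definition fourier_is_function (p1 p2 : R) (u0 : tempered_distribution)
    (f : R -> C) : Prop :=
  (forall p : R, p < p1 \/ p2 < p -> f p = 0%C) /\
  forall phi : R -> C, schwartz phi ->
    is_RInt_gen (V := C_R_NormedModule) (fun p => f p * phi p)%C
      (at_right p1) (at_left p2) (u0 (fourier phi)).

(* Continuously differentiable on the closed interval: the derivative is taken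
   relatively to [a, b], hence is one-sided at the endpoints. *)
Definition C1_on (a b : R) (g : R -> C) : Prop :=
  exists g' : R -> C,
    (forall p : R, a <= p <= b ->
       filterdiff (U := R_NormedModule) (V := C_R_NormedModule) g
         (within (fun q => a <= q <= b) (locally p))
         (fun h => RtoC h * g' p)%C) /\
    continuous_on (T := R_UniformSpace) (U := C_R_NormedModule)
      (fun q => a <= q <= b) g'.

(* [f] is the Fourier transform of [u0]. *)
Definition condition_C (p1 p2 mu : R) (u0 : tempered_distribution)
    (f : R -> C) : Prop :=
  fourier_is_function p1 p2 u0 f /\
  exists ut : R -> C,
    C1_on p1 p2 ut /\ ut p1 <> 0%C /\ ut p2 = 0%C /\
    forall p : R, p1 < p < p2 ->
      f p = (RtoC (Rpower (p - p1) (mu - 1)) * ut p)%C.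

(* F^{-1} (e^{-itp^2} F u0), where F u0 is the function [f] supported in
   [p1, p2]. *)
Definition schrodinger_solution (p1 p2 : R) (f : R -> C) (t x : R) : C :=
  (RtoC (/ (2 * PI)) *
   RInt_gen (V := C_R_CompleteNormedModule)
     (fun p => f p * expi (- (t * p ^ 2) + x * p))%C
     (at_right p1) (at_left p2))%C.

Definition region (eps p1 p2 t x : R) : Prop :=
  0 < t /\
  2 * p1 + 2 * Rpower t (- eps) <= x / t < 2 * p2 /\
  Rpower (p2 - p1) (- (1 / eps)) < t.

(* The exponents are numbered from 1. *)
Definition entry (l : list R) (k : nat) : R := nth (k - 1) l 0.

Definition alpha1 (mu gamma : R) : nat -> R :=
  entry [mu; 2 - mu; 1 - mu; 4 - mu; 1 + gamma - mu; gamma - mu;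
         3 - mu; 2 - mu; 1 - mu].
Definition beta1 (mu delta : R) : nat -> R :=
  entry [mu; 1; 1; 2; delta; delta; 3 / 2; delta; delta].

Definition alpha2 (mu gamma : R) : nat -> R :=
  entry [2 - mu; 1 - mu; 4 - mu; 1 + gamma - mu; gamma - mu;
         3 - mu; 2 - mu; 1 - mu].
Definition beta2 (delta : R) : nat -> R :=
  entry [1; 1; 2; delta; delta; 3 / 2; delta; delta].

Definition alpha3 (mu gamma : R) : nat -> R :=
  entry [1 - mu; 2 - mu; 1 - mu; 4 - mu; 1 + gamma - mu; gamma - mu;
         3 - mu; 2 - mu; 1 - mu].
Definition beta3 (delta : R) : nat -> R :=
  entry [1 / 2; 1; 1; 2; delta; delta; 3 / 2; delta; delta].

Definition upper_bound_on_region (eps p1 p2 : R) (u : R -> R -> C)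
    (rate : R) (n : nat) (alpha beta C_ : nat -> R) : Prop :=
  forall t x : R, region eps p1 p2 t x ->
    Cmod (u t x) <=
      C_ 0%nat * Rpower t rate
      + sum_n_m (fun k => C_ k * Rpower t (- beta k + eps * alpha k)) 1 n.

Definition max_exponent (eps : R) (n : nat) (alpha beta : nat -> R) : R :=
  MaxRlist (map (fun k => - beta k + eps * alpha k) (seq 1 n)).

(* The decay rate [t^rate] is attained on the left boundary
   x / t = 2 p1 + 2 t^{-eps} of the region. *)
Definition optimal_rate (eps p1 : R) (u : R -> R -> C) (rate : R) : Prop :=
  exists c T : R, 0 < c /\ 0 < T /\
    forall t : R, T <= t ->
      c * Rpower t rate
      <= Cmod (u t (2 * p1 * t + 2 * Rpower t (1 - eps))).

(* Main.v *)
Require Import Defs.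
From Stdlib Require Import Lra Lia Psatz.

(* Put [s = p - p1], [L = p2 - p1], [r = x / (2 t) - p1] and [w = t r^2].  Since
   the profile [g] vanishes at [L], one integration by parts turns the solution
   into [- int_0^L g' K], where, up to a unimodular factor, [K s = r^mu k (s / r)]
   and [k z = int_0^z y^(mu-1) e^{-i w (y-1)^2} dy].  Everything thus reduces to
   the model integral [k], with [w >= t^(1 - 2 eps) >= 1] when [t >= 1].

   Upper bound: [|k| <= B (w^(-mu) + w^(-1/2))], from the singularity [y = 0] and
   the stationary point [y = 1].

   Lower bound: with [E_mu X = int_0^X y^(mu-1) e^{iy} dy], [k 2] is close to
   [w^(-1/2) conj (E_{1/2} X) + e^{-iw} (2 w)^(-mu) E_mu X] for [X] large and then
   [w] much larger, and [|E_mu X|] stays away from [0].  The two terms have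
   different orders in [w] unless [mu = 1/2], when their moduli have the ratio
   [sqrt 2].  As [K s] is close to [r^mu k 2] except for [s = O(r)], the solution is
   close to [g 0 r^mu k 2].

   The increments of all these primitives are estimated by the mean value
   inequality, so no improper integral has to be manipulated. *)

(** In terms of [t] and [r] the upper bound reads r^mu (w^(-mu) + w^(-1/2)) = t^(-mu) r^(-mu) +
    t^(-1/2) r^(mu-1). Both powers of [r] are negative, so the worst case in the region is its left
    boundary r = t^(-eps), which yields the two exponents -mu + eps mu and -1/2 + eps (1 - mu). The
    larger one is the announced rate, the other is entry 1 of the list of corrections, and for mu =
    1/2 they coincide. The constants must not depend on [eps]; hence all estimates are stated in
    [t], [r] and [w], and [eps] enters only at the end.

    The obstacle to the lower bound is that the estimates away from 0 and 1 leave errors of the same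
    order in [w] as the main terms. The parameter [X] measures the cut-offs in the natural units 1/w
    near 0 and w^(-1/2) near 1; it gives these errors the small factors X^(mu-1) and X^(-1/2), so
    [X] is fixed before [w] grows. This is why the lower bound of |E_mu X| has to be uniform in
    [X]. *)

Local Notation is_Cderive :=
  (is_derive (K := R_AbsRing) (V := C_R_NormedModule)).
Local Notation Ccontinuous :=
  (continuous (T := R_UniformSpace) (U := C_R_NormedModule)).

(** * Complex-valued functions of a real variable *)

Lemma is_Cderive_pair (f : R -> C) (x : R) (l : C) :
  is_derive (fun y => fst (f y)) x (fst l) ->
  is_derive (fun y => snd (f y)) x (snd l) -> is_Cderive f x l.
Proof.
  intros H1 H2.
  pose proof (@is_derive_plus R_AbsRing C_R_NormedModule _ _ x _ _
    (@is_derive_scal_l R_AbsRing C_R_NormedModule _ x (fst l) (1, 0) H1)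
    (@is_derive_scal_l R_AbsRing C_R_NormedModule _ x (snd l) (0, 1) H2)) as H.
  eapply is_derive_ext in H; [replace l with (Cplus (fst l * 1, fst l * 0)
    (snd l * 0, snd l * 1)); [exact H|] |].
  - destruct l as [a b]. unfold Cplus; simpl. f_equal; ring.
  - intros y. simpl. destruct (f y) as [u v].
    unfold plus, scal; simpl; unfold prod_plus, prod_scal, plus, scal; simpl.
    unfold mult; simpl. f_equal; ring.
Qed.

Lemma is_Cderive_fst (f : R -> C) (x : R) (l : C) :
  is_Cderive f x l -> is_derive (fun y => fst (f y)) x (fst l).
Proof.
  intros H.
  apply (filterdiff_comp' (V := C_R_NormedModule) (W := R_NormedModule)
           f fst x _ fst H).
  apply (filterdiff_linear (U := C_R_NormedModule) (V := R_NormedModule)).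
  apply (is_linear_fst (U := R_NormedModule) (V := R_NormedModule)).
Qed.

Lemma is_Cderive_snd (f : R -> C) (x : R) (l : C) :
  is_Cderive f x l -> is_derive (fun y => snd (f y)) x (snd l).
Proof.
  intros H.
  apply (filterdiff_comp' (V := C_R_NormedModule) (W := R_NormedModule)
           f snd x _ snd H).
  apply (filterdiff_linear (U := C_R_NormedModule) (V := R_NormedModule)).
  apply (is_linear_snd (U := R_NormedModule) (V := R_NormedModule)).
Qed.

Lemma Ccontinuous_pair (f : R -> C) (x : R) :
  continuous (fun y => fst (f y)) x -> continuous (fun y => snd (f y)) x ->
  Ccontinuous f x.
Proof.
  intros H1 H2.
  apply (continuous_ext (fun y => (fst (f y), snd (f y)))).
  - intros y; now destruct (f y).
  - apply (continuous_comp_2 (V := R_UniformSpace) (W := R_UniformSpace)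
             (X := prod_UniformSpace R_UniformSpace R_UniformSpace)
             (fun y => fst (f y)) (fun y => snd (f y)) (fun a b => (a, b)) x H1 H2).
    apply (continuous_ext (fun z : prod_UniformSpace R_UniformSpace R_UniformSpace => z)).
    + now intros [a b].
    + apply continuous_id.
Qed.

Lemma Ccontinuous_fst (f : R -> C) (x : R) :
  Ccontinuous f x -> continuous (fun y => fst (f y)) x.
Proof.
  intros H.
  apply (continuous_comp (V := C_R_NormedModule) f fst x H).
  apply (continuous_fst (U := R_UniformSpace) (V := R_UniformSpace)).
Qed.

Lemma Ccontinuous_snd (f : R -> C) (x : R) :
  Ccontinuous f x -> continuous (fun y => snd (f y)) x.
Proof.
  intros H.
  apply (continuous_comp (V := C_R_NormedModule) f snd x H).
  apply (continuous_snd (U := R_UniformSpace) (V := R_UniformSpace)).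
Qed.

Lemma is_Cderive_continuous (f : R -> C) (x : R) (l : C) :
  is_Cderive f x l -> Ccontinuous f x.
Proof.
  intros H. apply (ex_derive_continuous (V := C_R_NormedModule)). now exists l.
Qed.

Lemma is_Cderive_mult (f g : R -> C) (x : R) (l m : C) :
  is_Cderive f x l -> is_Cderive g x m ->
  is_Cderive (fun y => f y * g y)%C x (l * g x + f x * m)%C.
Proof.
  intros Hf Hg.
  pose proof (is_Cderive_fst _ _ _ Hf). pose proof (is_Cderive_snd _ _ _ Hf).
  pose proof (is_Cderive_fst _ _ _ Hg). pose proof (is_Cderive_snd _ _ _ Hg).
  apply is_Cderive_pair; simpl.
  - evar_last.
    + apply @is_derive_minus; apply @is_derive_mult; try eassumption;
        intros; apply Rmult_comm.
    + unfold minus, plus, opp, mult; simpl. ring.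
  - evar_last.
    + apply @is_derive_plus; apply @is_derive_mult; try eassumption;
        intros; apply Rmult_comm.
    + unfold plus, mult; simpl. ring.
Qed.

Lemma is_Cderive_minus (f g : R -> C) (x : R) (l m : C) :
  is_Cderive f x l -> is_Cderive g x m ->
  is_Cderive (fun y => f y - g y)%C x (l - m)%C.
Proof. exact (@is_derive_minus _ C_R_NormedModule f g x l m). Qed.

Lemma is_Cderive_plus (f g : R -> C) (x : R) (l m : C) :
  is_Cderive f x l -> is_Cderive g x m ->
  is_Cderive (fun y => f y + g y)%C x (l + m)%C.
Proof. exact (@is_derive_plus _ C_R_NormedModule f g x l m). Qed.

Lemma is_Cderive_const (c : C) (x : R) : is_Cderive (fun _ => c) x (RtoC 0).
Proof. exact (@is_derive_const _ C_R_NormedModule c x). Qed.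

Lemma is_Cderive_cmult (c : C) (f : R -> C) (x : R) (l : C) :
  is_Cderive f x l -> is_Cderive (fun y => c * f y)%C x (c * l)%C.
Proof.
  intros H. evar_last.
  - apply is_Cderive_mult; [apply is_Cderive_const | exact H].
  - simpl. ring.
Qed.

Lemma is_Cderive_RtoC (f : R -> R) (x l : R) :
  is_derive f x l -> is_Cderive (fun y => RtoC (f y)) x (RtoC l).
Proof.
  intros H. apply is_Cderive_pair; simpl; [exact H | apply @is_derive_const].
Qed.

Lemma is_Cderive_comp (f : R -> C) (g : R -> R) (x : R) (l : C) (m : R) :
  is_Cderive f (g x) l -> is_derive g x m ->
  is_Cderive (fun y => f (g y)) x (RtoC m * l)%C.
Proof.
  intros Hf Hg. evar_last.
  - apply (@is_derive_comp _ C_R_NormedModule f g x l m Hf Hg).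
  - destruct l as [a b].
    unfold scal; simpl; unfold prod_scal, scal; simpl; unfold mult; simpl.
    unfold Cmult, RtoC; simpl. f_equal; ring.
Qed.

Lemma is_Cderive_expi (th : R -> R) (x l : R) :
  is_derive th x l ->
  is_Cderive (fun y => expi (th y)) x (Ci * RtoC l * expi (th x))%C.
Proof.
  intros H. apply is_Cderive_pair; simpl.
  - evar_last.
    + apply (is_derive_comp cos th x (- sin (th x)) l); [apply is_derive_cos | exact H].
    + unfold scal; simpl; unfold mult; simpl. ring.
  - evar_last.
    + apply (is_derive_comp sin th x (cos (th x)) l); [apply is_derive_sin | exact H].
    + unfold scal; simpl; unfold mult; simpl. ring.
Qed.

Lemma is_Cderive_conj (f : R -> C) (x : R) (l : C) :
  is_Cderive f x l -> is_Cderive (fun y => Cconj (f y)) x (Cconj l).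
Proof.
  intros H. apply is_Cderive_pair; simpl.
  - now apply is_Cderive_fst.
  - apply (@is_derive_opp _ R_NormedModule (fun y => snd (f y))).
    now apply is_Cderive_snd.
Qed.

Lemma Ccontinuous_mult (f g : R -> C) (x : R) :
  Ccontinuous f x -> Ccontinuous g x -> Ccontinuous (fun y => f y * g y)%C x.
Proof.
  intros Hf Hg.
  pose proof (Ccontinuous_fst _ _ Hf). pose proof (Ccontinuous_snd _ _ Hf).
  pose proof (Ccontinuous_fst _ _ Hg). pose proof (Ccontinuous_snd _ _ Hg).
  apply Ccontinuous_pair; simpl.
  - apply (@continuous_minus _ _ R_NormedModule); apply (@continuous_mult _ R_AbsRing);
      assumption.
  - apply (@continuous_plus _ _ R_NormedModule); apply (@continuous_mult _ R_AbsRing);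
      assumption.
Qed.

Lemma Ccontinuous_minus (f g : R -> C) (x : R) :
  Ccontinuous f x -> Ccontinuous g x -> Ccontinuous (fun y => f y - g y)%C x.
Proof. exact (@continuous_minus _ R_AbsRing C_R_NormedModule f g x). Qed.

Lemma Ccontinuous_const (c : C) (x : R) : Ccontinuous (fun _ => c) x.
Proof. exact (@continuous_const R_UniformSpace C_R_NormedModule c x). Qed.

Lemma Ccontinuous_comp (f : R -> C) (g : R -> R) (x : R) :
  continuous g x -> Ccontinuous f (g x) -> Ccontinuous (fun y => f (g y)) x.
Proof. intros Hg Hf. exact (continuous_comp (W := C_R_NormedModule) g f x Hg Hf). Qed.

Lemma continuous_Cmod (f : R -> C) (x : R) :
  Ccontinuous f x -> continuous (fun y => Cmod (f y)) x.
Proof.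
  intros H.
  pose proof (Ccontinuous_fst _ _ H) as H1. pose proof (Ccontinuous_snd _ _ H) as H2.
  apply (continuous_ext (fun y => sqrt (fst (f y) * fst (f y) + snd (f y) * snd (f y)))).
  - intros y. unfold Cmod. f_equal. simpl. ring.
  - apply (continuous_comp (fun y => fst (f y) * fst (f y) + snd (f y) * snd (f y)) sqrt).
    + exact (@continuous_plus _ R_AbsRing R_NormedModule _ _ x
        (@continuous_mult _ R_AbsRing _ _ x H1 H1)
        (@continuous_mult _ R_AbsRing _ _ x H2 H2)).
    + apply continuous_sqrt.
Qed.

Lemma Cmod_expi (th : R) : Cmod (expi th) = 1.
Proof.
  unfold Cmod, expi; simpl. transitivity (sqrt 1); [f_equal | apply sqrt_1].
  pose proof (sin2_cos2 th). unfold Rsqr in *. lra.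
Qed.

Lemma expi_plus (a b : R) : expi (a + b) = (expi a * expi b)%C.
Proof.
  unfold expi, Cmult; simpl. rewrite cos_plus, sin_plus. f_equal; ring.
Qed.

Lemma Cmod_conj (z : C) : Cmod (Cconj z) = Cmod z.
Proof. unfold Cmod; simpl. f_equal. ring. Qed.

Lemma Cmod_nonneg_mult (r : R) (z : C) : 0 <= r -> Cmod (RtoC r * z) = r * Cmod z.
Proof. intros H. now rewrite Cmod_mult, Cmod_R, Rabs_pos_eq. Qed.

Lemma Cmod_triangle_minus (a b : C) : Cmod (a - b) <= Cmod a + Cmod b.
Proof. rewrite <- (Cmod_opp b). apply Cmod_triangle. Qed.

Lemma Cmod_triangle_inv (a b : C) : Cmod a - Cmod b <= Cmod (a + b).
Proof.
  replace a with ((a + b) - b)%C at 1 by ring.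
  pose proof (Cmod_triangle_minus (a + b) b). lra.
Qed.

(** * Mean value inequality and first derivative test *)

Lemma nondecreasing_of_derive (f df : R -> R) (a b : R) :
  a <= b ->
  (forall x, a <= x <= b -> continuous f x) ->
  (forall x, a < x < b -> is_derive f x (df x)) ->
  (forall x, a < x < b -> 0 <= df x) -> f a <= f b.
Proof.
  intros Hab Hc Hd Hp.
  (* The intermediate point may be an endpoint, where nothing is known of [df]; the derivative
     handed over is therefore set to 0 outside the open interval, so that it is nonnegative
     everywhere. *)
  destruct (MVT_gen f a b
    (fun x => if Rlt_dec a x then if Rlt_dec x b then df x else 0 else 0)) as [c [_ E]].
  - rewrite Rmin_left, Rmax_right by lra. intros x Hx.
    destruct (Rlt_dec a x); [|lra]. destruct (Rlt_dec x b); [|lra]. auto.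
  - rewrite Rmin_left, Rmax_right by lra. intros x Hx.
    apply continuity_pt_filterlim. now apply Hc.
  - enough (0 <= f b - f a) by lra. rewrite E. apply Rmult_le_pos; [|lra].
    destruct (Rlt_dec a c); [|lra]. destruct (Rlt_dec c b); [|lra]. auto.
Qed.

(* Project [f] on the direction of [f b - f a], then use the real mean value
   theorem. *)
Lemma Cmod_increment_le (f f' : R -> C) (q q' : R -> R) (a b : R) :
  a <= b ->
  (forall x, a <= x <= b -> Ccontinuous f x) ->
  (forall x, a <= x <= b -> continuous q x) ->
  (forall x, a < x < b -> is_Cderive f x (f' x)) ->
  (forall x, a < x < b -> is_derive q x (q' x)) ->
  (forall x, a < x < b -> Cmod (f' x) <= q' x) ->
  Cmod (f b - f a) <= q b - q a.
Proof.
  intros Hab Hcf Hcq Hf Hq Hle.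
  set (z := (f b - f a)%C). set (rho := Cmod z).
  assert (Hrho : 0 <= rho) by apply Cmod_ge_0.
  assert (H2 : fst z ^ 2 + snd z ^ 2 = rho * rho).
  { unfold rho, Cmod. rewrite sqrt_sqrt; [reflexivity|nra]. }
  set (h := fun x => rho * q x - (fst z * fst (f x) + snd z * snd (f x))).
  assert (Hh : h a <= h b).
  { apply (nondecreasing_of_derive h
      (fun x => rho * q' x - (fst z * fst (f' x) + snd z * snd (f' x)))); auto.
    - intros x Hx. specialize (Hcf x Hx).
      pose proof (Ccontinuous_fst _ _ Hcf). pose proof (Ccontinuous_snd _ _ Hcf).
      unfold h. apply (@continuous_minus _ _ R_NormedModule);
        [|apply (@continuous_plus _ _ R_NormedModule)];
        apply (@continuous_mult _ R_AbsRing); auto; apply continuous_const.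
    - intros x Hx. specialize (Hf x Hx). specialize (Hq x Hx).
      pose proof (is_Cderive_fst _ _ _ Hf). pose proof (is_Cderive_snd _ _ _ Hf).
      unfold h.
      apply @is_derive_minus; [|apply @is_derive_plus]; now apply is_derive_scal.
    - intros x Hx. specialize (Hle x Hx).
      set (m := Cmod (f' x)) in *.
      assert (0 <= m) by apply Cmod_ge_0.
      assert (M2 : fst (f' x) ^ 2 + snd (f' x) ^ 2 = m * m).
      { unfold m, Cmod. rewrite sqrt_sqrt; [reflexivity|nra]. }
      (* Cauchy-Schwarz in the plane, from Lagrange's identity: the two squares differ by the square
         of the determinant. *)
      assert (fst z * fst (f' x) + snd z * snd (f' x) <= rho * m); [|nra].
      apply Rsqr_incr_0_var; [unfold Rsqr|nra].
      assert (0 <= (fst z * snd (f' x) - snd z * fst (f' x)) ^ 2) by apply pow2_ge_0.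
      replace (rho * m * (rho * m)) with ((rho * rho) * (m * m)) by ring.
      rewrite <- H2, <- M2. nra. }
  unfold h in Hh.
  assert (E1 : fst z = fst (f b) - fst (f a)) by reflexivity.
  assert (E2 : snd z = snd (f b) - snd (f a)) by reflexivity.
  assert (Hk : rho * rho <= rho * (q b - q a)) by (rewrite <- H2; nra).
  (* For [rho = 0] the projection carries no information, and the claim is that [q] does not
     decrease. *)
  destruct (Req_dec rho 0) as [E | E].
  - rewrite E.
    enough (q a <= q b) by lra.
    apply (nondecreasing_of_derive q q'); auto.
    intros x Hx. eapply Rle_trans; [apply Cmod_ge_0 | apply Hle, Hx].
  - apply Rmult_le_reg_l with rho; lra.
Qed.

(* One integration by parts: [f + i al e^{i th}] has derivative
   [i al' e^{i th}]. *)
Lemma first_derivative_test (f : R -> C) (th th' al al' q q' : R -> R) (a b : R) :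
  a <= b ->
  (forall x, a <= x <= b -> is_Cderive f x (RtoC (al x * th' x) * expi (th x))%C) ->
  (forall x, a <= x <= b -> is_derive th x (th' x)) ->
  (forall x, a <= x <= b -> is_derive al x (al' x)) ->
  (forall x, a <= x <= b -> is_derive q x (q' x)) ->
  (forall x, a <= x <= b -> Rabs (al' x) <= q' x) ->
  Cmod (f b - f a) <= Rabs (al a) + Rabs (al b) + (q b - q a).
Proof.
  intros Hab Hf Hth Hal Hq Hle.
  set (g := fun x => (f x + Ci * (RtoC (al x) * expi (th x)))%C).
  assert (Hg : forall x, a <= x <= b ->
            is_Cderive g x (Ci * (RtoC (al' x) * expi (th x)))%C).
  { intros x Hx. unfold g. evar_last.
    - apply is_Cderive_plus; [apply Hf, Hx|]. apply is_Cderive_cmult.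
      apply is_Cderive_mult; [apply is_Cderive_RtoC, Hal, Hx|].
      apply is_Cderive_expi, Hth, Hx.
    - simpl. rewrite RtoC_mult.
      unfold Cmult, Cplus, Ci, RtoC, expi; simpl. f_equal; ring. }
  assert (B : Cmod (g b - g a) <= q b - q a).
  { apply (Cmod_increment_le g (fun x => (Ci * (RtoC (al' x) * expi (th x)))%C) q q' a b Hab).
    - intros x Hx. eapply is_Cderive_continuous, Hg, Hx.
    - intros x Hx. apply (ex_derive_continuous (V := R_NormedModule)).
      exists (q' x). now apply Hq.
    - intros x Hx. apply Hg. lra.
    - intros x Hx. apply Hq. lra.
    - intros x Hx. rewrite !Cmod_mult, Cmod_R, Cmod_expi, Cmod_Ci.
      rewrite Rmult_1_l, Rmult_1_r. apply Hle. lra. }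
  assert (M : forall x, Cmod (Ci * (RtoC (al x) * expi (th x))) = Rabs (al x)).
  { intros x. rewrite !Cmod_mult, Cmod_R, Cmod_expi, Cmod_Ci. ring. }
  replace (f b - f a)%C with ((g b - g a) - (Ci * (RtoC (al b) * expi (th b))
      - Ci * (RtoC (al a) * expi (th a))))%C by (unfold g; ring).
  eapply Rle_trans; [apply Cmod_triangle_minus|].
  pose proof (Cmod_triangle_minus (Ci * (RtoC (al b) * expi (th b)))
     (Ci * (RtoC (al a) * expi (th a)))) as T.
  rewrite !M in T. lra.
Qed.

(** * Primitives with an algebraic singularity *)

Lemma is_derive_Rpower (a x : R) :
  0 < x -> is_derive (fun y => Rpower y a) x (a * Rpower x (a - 1)).
Proof.
  intros Hx. unfold Rpower at 1. auto_derive; [exact Hx|].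
  unfold Rminus. rewrite Rpower_plus, Rpower_Ropp, Rpower_1 by lra.
  unfold Rpower. ring.
Qed.

(* [Rpower 0 a = 1] in Rocq, hence the truncation at [0]. *)
Definition pos_power (a x : R) : R := if Rlt_dec 0 x then Rpower x a else 0.

Lemma pos_power_eq (a x : R) : 0 < x -> pos_power a x = Rpower x a.
Proof. intros H. unfold pos_power. destruct (Rlt_dec 0 x); [easy|lra]. Qed.

Lemma pos_power_0 (a : R) : pos_power a 0 = 0.
Proof. unfold pos_power. destruct (Rlt_dec 0 0); lra. Qed.

Lemma is_derive_pos_power (a x : R) :
  0 < x -> is_derive (pos_power a) x (a * Rpower x (a - 1)).
Proof.
  intros Hx. apply (is_derive_ext_loc (fun y => Rpower y a)).
  - exists (mkposreal x Hx). intros y Hy.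
    unfold ball in Hy; simpl in Hy; unfold AbsRing_ball, abs, minus, plus, opp in Hy.
    simpl in Hy. apply Rabs_def2 in Hy. rewrite pos_power_eq; [reflexivity|lra].
  - now apply is_derive_Rpower.
Qed.

Lemma continuous_pos_power (a x : R) : 0 < a -> continuous (pos_power a) x.
Proof.
  intros Ha. destruct (Rtotal_order x 0) as [Hx | [Hx | Hx]].
  - apply (continuous_ext_loc _ (fun _ => 0)); [|apply continuous_const].
    assert (Hx' : 0 < - x) by lra.
    exists (mkposreal (- x) Hx'). intros y Hy.
    unfold ball in Hy; simpl in Hy; unfold AbsRing_ball, abs, minus, plus, opp in Hy.
    simpl in Hy. apply Rabs_def2 in Hy.
    unfold pos_power. destruct (Rlt_dec 0 y); lra.
  - subst x. unfold continuous. rewrite pos_power_0.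
    apply filterlim_locally. intros eps.
    assert (Hd : 0 < Rpower eps (/ a)) by apply exp_pos.
    exists (mkposreal _ Hd). intros y Hy.
    unfold ball in *; simpl in *; unfold AbsRing_ball, abs, minus, plus, opp in *.
    simpl in *. rewrite Ropp_0, Rplus_0_r in *.
    unfold pos_power. destruct (Rlt_dec 0 y) as [H|H].
    + rewrite Rabs_pos_eq in * by (try apply Rlt_le, exp_pos; lra).
      replace (pos eps) with (Rpower (Rpower eps (/ a)) a).
      * apply Rlt_Rpower_l; lra.
      * rewrite Rpower_mult, Rinv_l, Rpower_1; [easy|apply cond_pos|lra].
    + rewrite Rabs_R0. apply cond_pos.
  - apply (ex_derive_continuous (V := R_NormedModule)).
    eexists. now apply is_derive_pos_power.
Qed.

(** The improper integral of y^(mu-1) phi(y) from 0 to x, encoded by its value at 0, its continuity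
    and its derivative on x > 0, which determine it for x >= 0. Continuity on the whole line spares
    side conditions when [k] is composed with other maps. *)
Definition singular_primitive (mu : R) (phi k : R -> C) : Prop :=
  k 0 = RtoC 0 /\ (forall x, Ccontinuous k x) /\
  forall x, 0 < x -> is_Cderive k x (RtoC (Rpower x (mu - 1)) * phi x)%C.

(* Integrating by parts removes the singularity:
   [(x^mu phi x - RInt (s^mu phi' s)) / mu]. *)
Lemma singular_primitive_real (mu : R) (phi phi' : R -> R) :
  0 < mu -> (forall x, is_derive phi x (phi' x)) -> (forall x, continuous phi' x) ->
  exists f : R -> R, f 0 = 0 /\ (forall x, continuous f x) /\
    forall x, 0 < x -> is_derive f x (Rpower x (mu - 1) * phi x).
Proof.
  intros Hmu Hphi Hphi'.
  set (h := fun s => pos_power mu s * phi' s).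
  assert (Hh : forall x, continuous h x).
  { intros x. apply (@continuous_mult _ R_AbsRing); [|apply Hphi'].
    now apply continuous_pos_power. }
  assert (HI : forall x, is_derive (fun y => RInt h 0 y) x (h x)).
  { intros x. apply (is_derive_RInt h _ 0).
    - apply filter_forall. intros b. apply (RInt_correct h).
      apply (ex_RInt_continuous h). intros; apply Hh.
    - apply Hh. }
  exists (fun x => / mu * (pos_power mu x * phi x - RInt h 0 x)). split; [|split].
  - rewrite pos_power_0, RInt_point. unfold zero; simpl. ring.
  - intros x. apply (@continuous_mult _ R_AbsRing); [apply continuous_const|].
    apply (@continuous_minus _ _ R_NormedModule).
    + apply (@continuous_mult _ R_AbsRing); [now apply continuous_pos_power|].
      apply (ex_derive_continuous (V := R_NormedModule)). eexists; apply Hphi.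
    + apply (ex_derive_continuous (V := R_NormedModule)). eexists; apply HI.
  - intros x Hx. evar_last.
    + apply is_derive_scal. apply @is_derive_minus; [|apply HI].
      apply @is_derive_mult; [now apply is_derive_pos_power|apply Hphi|apply Rmult_comm].
    + unfold h, minus, plus, opp, mult; simpl. field. lra.
Qed.

Lemma singular_primitive_exists (mu : R) (phi phi' : R -> C) :
  0 < mu -> (forall x, is_Cderive phi x (phi' x)) ->
  (forall x, Ccontinuous phi' x) -> exists k, singular_primitive mu phi k.
Proof.
  intros Hmu Hphi Hphi'.
  destruct (singular_primitive_real mu (fun x => fst (phi x)) (fun x => fst (phi' x)))
    as [f1 [F0 [Fc Fd]]]; auto.
  { intros x; now apply is_Cderive_fst. }
  { intros x; now apply Ccontinuous_fst. }
  destruct (singular_primitive_real mu (fun x => snd (phi x)) (fun x => snd (phi' x)))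
    as [f2 [G0 [Gc Gd]]]; auto.
  { intros x; now apply is_Cderive_snd. }
  { intros x; now apply Ccontinuous_snd. }
  exists (fun x => (f1 x, f2 x)). split; [|split].
  - now rewrite F0, G0.
  - intros x. apply Ccontinuous_pair; simpl; auto.
  - intros x Hx. apply is_Cderive_pair; simpl.
    + rewrite Rmult_0_l, Rminus_0_r. auto.
    + rewrite Rmult_0_l, Rplus_0_r. auto.
Qed.

Lemma singular_primitive_le (mu : R) (phi k : R -> C) (x : R) :
  0 < mu -> singular_primitive mu phi k -> (forall y, Cmod (phi y) <= 1) -> 0 <= x ->
  Cmod (k x) <= pos_power mu x / mu.
Proof.
  intros Hmu [K0 [Kc Kd]] Hphi Hx.
  replace (k x) with (k x - k 0)%C by (rewrite K0; ring).
  replace (pos_power mu x / mu) with (/ mu * pos_power mu x - / mu * pos_power mu 0)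
    by (rewrite pos_power_0; field; lra).
  apply (Cmod_increment_le k (fun x => RtoC (Rpower x (mu - 1)) * phi x)%C
    (fun x => / mu * pos_power mu x) (fun x => / mu * (mu * Rpower x (mu - 1)))); auto.
  - intros y Hy. apply (@continuous_mult _ R_AbsRing); [apply continuous_const|].
    now apply continuous_pos_power.
  - intros y Hy. apply Kd; lra.
  - intros y Hy. apply is_derive_scal, is_derive_pos_power; lra.
  - intros y Hy. rewrite Cmod_nonneg_mult by apply Rlt_le, exp_pos.
    replace (/ mu * (mu * Rpower y (mu - 1))) with (Rpower y (mu - 1) * 1) by (field; lra).
    apply Rmult_le_compat_l; [apply Rlt_le, exp_pos | apply Hphi].
Qed.

Definition quad_phase (w y : R) : R := - (w * (y - 1) ^ 2).

Lemma is_derive_quad_phase (w y : R) :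
  is_derive (quad_phase w) y (- (2 * w * (y - 1))).
Proof. unfold quad_phase. auto_derive; [easy|ring]. Qed.

Lemma quad_primitive_exists (mu w : R) :
  0 < mu -> exists k, singular_primitive mu (fun y => expi (quad_phase w y)) k.
Proof.
  intros Hmu.
  apply (singular_primitive_exists mu _ (fun y => Ci * RtoC (- (2 * w * (y - 1)))
           * expi (quad_phase w y))%C Hmu).
  - intros x. apply is_Cderive_expi, is_derive_quad_phase.
  - intros x. apply Ccontinuous_mult.
    + apply Ccontinuous_mult; [apply Ccontinuous_const|].
      eapply is_Cderive_continuous, is_Cderive_RtoC. auto_derive; [easy|reflexivity].
    + eapply is_Cderive_continuous, is_Cderive_expi, is_derive_quad_phase.
Qed.

Lemma lin_primitive_exists (mu : R) :
  0 < mu -> exists k, singular_primitive mu expi k.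
Proof.
  intros Hmu.
  assert (H : forall x, is_Cderive expi x (Ci * RtoC 1 * expi x)%C).
  { intros x. apply (is_Cderive_expi (fun y => y)). apply @is_derive_id. }
  apply (singular_primitive_exists mu _ _ Hmu H).
  intros x. apply Ccontinuous_mult; [apply Ccontinuous_const|].
  eapply is_Cderive_continuous, H.
Qed.

(** * The model integral *)

Lemma Rpower_decreasing (x y a : R) :
  a <= 0 -> 0 < x <= y -> Rpower y a <= Rpower x a.
Proof.
  intros Ha Hx. replace a with (- - a) by ring. rewrite !(Rpower_Ropp _ (- a)).
  apply Rinv_le_contravar; [apply exp_pos|]. apply Rle_Rpower_l; lra.
Qed.

Lemma Rpower_shift (x a : R) : 0 < x -> Rpower x (a - 1) = Rpower x a / x.
Proof.
  intros Hx. unfold Rminus. rewrite Rpower_plus, Rpower_Ropp, Rpower_1 by lra.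
  reflexivity.
Qed.

Lemma Rpower_inv_base (x a : R) : 0 < x -> Rpower (/ x) a = Rpower x (- a).
Proof. intros Hx. unfold Rpower. rewrite ln_Rinv by exact Hx. f_equal. ring. Qed.

Lemma Rpower_base_1 (a : R) : Rpower 1 a = 1.
Proof. unfold Rpower. now rewrite ln_1, Rmult_0_r, exp_0. Qed.

Lemma Rpower_le_1 (x a : R) : 1 <= x -> a <= 0 -> Rpower x a <= 1.
Proof.
  intros Hx Ha. rewrite <- (Rpower_base_1 a). apply Rpower_decreasing; lra.
Qed.

(** The weight is at most 2^(1-mu) on this half-line; the point 1/2 separates the singularity from
    the stationary point throughout. *)
Lemma Rpower_ge_half (mu y : R) : 0 < mu < 1 -> 1 / 2 <= y -> Rpower y (mu - 1) <= 2.
Proof.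
  intros Hmu Hy. apply Rle_trans with (Rpower (/ 2) (mu - 1)).
  - apply Rpower_decreasing; lra.
  - rewrite Rpower_inv_base by lra. apply Rle_trans with (Rpower 2 1); [|rewrite Rpower_1; lra].
    apply Rle_Rpower; lra.
Qed.

(** The weight divided by the derivative of [quad_phase]: the function [al] of
    [first_derivative_test], singular at 0 and at 1. *)
Definition quad_amplitude (mu w y : R) : R :=
  Rpower y (mu - 1) * / (- (2 * w * (y - 1))).

(** The derivative, with y^(mu-2) written as a quotient so that the single power y^(mu-1) can be
    factored out. *)
Definition quad_amplitude' (mu w y : R) : R :=
  (mu - 1) * (Rpower y (mu - 1) / y) * / (- (2 * w * (y - 1)))
  + Rpower y (mu - 1) * / (2 * w * (y - 1) ^ 2).

Lemma is_derive_quad_amplitude (mu w y : R) :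
  0 < w -> 0 < y -> y <> 1 ->
  is_derive (quad_amplitude mu w) y (quad_amplitude' mu w y).
Proof.
  intros Hw Hy H1. unfold quad_amplitude, quad_amplitude'. evar_last.
  - apply @is_derive_mult; [now apply is_derive_Rpower | | apply Rmult_comm].
    instantiate (1 := / (2 * w * (y - 1) ^ 2)).
    auto_derive.
    + apply Ropp_neq_0_compat, Rmult_integral_contrapositive_currified; lra.
    + field. lra.
  - unfold plus, mult; simpl. rewrite (Rpower_shift y (mu - 1)) by exact Hy. ring.
Qed.

Lemma Rabs_quad_amplitude (mu w y : R) :
  0 < w -> y <> 1 ->
  Rabs (quad_amplitude mu w y) = Rpower y (mu - 1) / (2 * w * Rabs (y - 1)).
Proof.
  intros Hw Hy. unfold quad_amplitude, Rdiv.
  rewrite Rabs_mult, Rabs_inv, Rabs_Ropp, Rabs_mult.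
  rewrite (Rabs_pos_eq (Rpower _ _)) by apply Rlt_le, exp_pos.
  now rewrite (Rabs_pos_eq (2 * w)) by lra.
Qed.

(** The logarithmic derivative of the amplitude is (mu - 1) / y - 1 / (y - 1), and 1 - mu <= 1. *)
Lemma Rabs_quad_amplitude' (mu w y : R) :
  0 < mu < 1 -> 0 < w -> 0 < y -> y <> 1 ->
  Rabs (quad_amplitude' mu w y)
  <= Rpower y (mu - 1) / (2 * w * Rabs (y - 1)) * (/ y + / Rabs (y - 1)).
Proof.
  intros Hmu Hw Hy H1. unfold quad_amplitude'.
  assert (Hu : 0 < Rabs (y - 1)) by (apply Rabs_pos_lt; lra).
  assert (HP : 0 < Rpower y (mu - 1)) by apply exp_pos.
  set (P := Rpower y (mu - 1)) in *.
  eapply Rle_trans; [apply Rabs_triang|].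
  rewrite !Rabs_mult, !Rabs_inv, Rabs_Ropp, !Rabs_mult.
  rewrite (Rabs_left (mu - 1)) by lra.
  rewrite <- RPow_abs.
  rewrite (Rabs_pos_eq (P / y)) by (apply Rlt_le, Rdiv_lt_0_compat; lra).
  rewrite (Rabs_pos_eq P), (Rabs_pos_eq 2), (Rabs_pos_eq w) by lra.
  set (u := Rabs (y - 1)) in *.
  replace (P / (2 * w * u) * (/ y + / u))
    with (1 * (P / y * / (2 * w * u)) + P * / (2 * w * u ^ 2)) by (field; lra).
  apply Rplus_le_compat_r. rewrite Rmult_assoc.
  apply Rmult_le_compat_r; [|lra].
  apply Rmult_le_pos; apply Rlt_le; [apply Rdiv_lt_0_compat; lra|].
  apply Rinv_0_lt_compat. apply Rmult_lt_0_compat; lra.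
Qed.

Lemma quad_primitive_test (mu w : R) (k : R -> C) (q q' : R -> R) (a b : R) :
  0 < w -> singular_primitive mu (fun y => expi (quad_phase w y)) k ->
  0 < a <= b -> (forall y, a <= y <= b -> y <> 1) ->
  (forall y, a <= y <= b -> is_derive q y (q' y)) ->
  (forall y, a <= y <= b -> Rabs (quad_amplitude' mu w y) <= q' y) ->
  Cmod (k b - k a)
  <= Rabs (quad_amplitude mu w a) + Rabs (quad_amplitude mu w b) + (q b - q a).
Proof.
  intros Hw [_ [_ Kd]] Hab H1 Hq Hle.
  apply (first_derivative_test k (quad_phase w) (fun y => - (2 * w * (y - 1)))
    (quad_amplitude mu w) (quad_amplitude' mu w) q q' a b); auto.
  - lra.
  - intros y Hy. specialize (H1 y Hy). evar_last; [apply Kd; lra|].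
    do 2 f_equal. unfold quad_amplitude. field. split; lra.
  - intros y Hy. apply is_derive_quad_phase.
  - intros y Hy. apply is_derive_quad_amplitude; auto; lra.
Qed.

(** For y >= 1/2 one has |y - 1| <= y, so the amplitude has derivative at most 2 / (w (y-1)^2), with
    primitive -2 / (w (y-1)). Each boundary term costs 1 / (w eta) and the variation 2 / (w eta). *)
Lemma quad_increment_away (mu w : R) (k : R -> C) (a b eta : R) :
  0 < mu < 1 -> 0 < w -> singular_primitive mu (fun y => expi (quad_phase w y)) k ->
  1 / 2 <= a <= b -> 0 < eta -> b <= 1 - eta \/ 1 + eta <= a ->
  Cmod (k b - k a) <= 4 / (w * eta).
Proof.
  intros Hmu Hw Hk Hab Heta Hcase.
  assert (Hu : forall y, a <= y <= b -> eta <= Rabs (y - 1)).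
  { intros y Hy. destruct Hcase; [rewrite Rabs_left|rewrite Rabs_pos_eq]; lra. }
  assert (Hy1 : forall y, a <= y <= b -> y <> 1).
  { intros y Hy E. specialize (Hu y Hy). rewrite E, Rminus_diag, Rabs_R0 in Hu. lra. }
  eapply Rle_trans.
  - apply (quad_primitive_test mu w k (fun y => - (2 / w) * / (y - 1))
      (fun y => 2 / (w * (y - 1) ^ 2)) a b Hw Hk); auto; try lra.
    + intros y Hy. specialize (Hy1 y Hy). auto_derive; [lra|field; lra].
    + intros y Hy. specialize (Hy1 y Hy). specialize (Hu y Hy).
      eapply Rle_trans; [apply Rabs_quad_amplitude'; auto; lra|].
      rewrite <- (Rsqr_pow2 (y - 1)), (Rsqr_abs (y - 1)), Rsqr_pow2.
      assert (HP : Rpower y (mu - 1) <= 2) by (apply Rpower_ge_half; lra).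
      assert (Huy : Rabs (y - 1) <= y) by (apply Rabs_le; lra).
      set (u := Rabs (y - 1)) in *.
      replace (2 / (w * u ^ 2)) with (2 / (2 * w * u) * (/ u + / u)) by (field; lra).
      assert (0 < u) by lra. assert (0 < / (2 * w * u)) by (apply Rinv_0_lt_compat; nra).
      apply Rmult_le_compat.
      * apply Rmult_le_pos; [apply Rlt_le, exp_pos | lra].
      * apply Rlt_le, Rplus_lt_0_compat; apply Rinv_0_lt_compat; lra.
      * apply Rmult_le_compat_r; lra.
      * apply Rplus_le_compat_r. apply Rinv_le_contravar; lra.
  - assert (Q : forall y, a <= y <= b -> Rabs (quad_amplitude mu w y) <= 1 / (w * eta)).
    { intros y Hy. specialize (Hy1 y Hy). specialize (Hu y Hy).
      rewrite Rabs_quad_amplitude by auto.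
      assert (HP : Rpower y (mu - 1) <= 2) by (apply Rpower_ge_half; lra).
      replace (1 / (w * eta)) with (2 * / (2 * w * eta)) by (field; lra).
      apply Rmult_le_compat; auto.
      - apply Rlt_le, exp_pos.
      - apply Rlt_le, Rinv_0_lt_compat. nra.
      - apply Rinv_le_contravar; nra. }
    pose proof (Q a ltac:(lra)). pose proof (Q b ltac:(lra)).
    assert (- (2 / w) * / (b - 1) - - (2 / w) * / (a - 1) <= 2 / (w * eta)).
    { replace (- (2 / w) * / (b - 1) - - (2 / w) * / (a - 1))
        with (2 / w * (/ (a - 1) - / (b - 1)))
        by (field; pose proof (Hy1 a); pose proof (Hy1 b); lra).
      replace (2 / (w * eta)) with (2 / w * / eta) by (field; lra).
      apply Rmult_le_compat_l; [apply Rlt_le, Rdiv_lt_0_compat; lra|].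
      destruct Hcase.
      - assert (/ (1 - b) <= / eta) by (apply Rinv_le_contravar; lra).
        assert (0 < / (1 - a)) by (apply Rinv_0_lt_compat; lra).
        replace (a - 1) with (- (1 - a)) by ring. replace (b - 1) with (- (1 - b)) by ring.
        rewrite !Rinv_opp. lra.
      - assert (/ (a - 1) <= / eta) by (apply Rinv_le_contravar; lra).
        assert (0 < / (b - 1)) by (apply Rinv_0_lt_compat; lra). lra. }
    replace (4 / (w * eta)) with (1 / (w * eta) + 1 / (w * eta) + 2 / (w * eta))
      by (field; lra). lra.
Qed.

(** Here 1 - y is at least both 1/2 and y, so the amplitude is at most y^(mu-1) / w and its
    derivative at most 2 y^(mu-2) / w; integrating the latter produces the factor 1 / (1 - mu). *)
Lemma quad_increment_left (mu w : R) (k : R -> C) (a b : R) :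
  0 < mu < 1 -> 0 < w -> singular_primitive mu (fun y => expi (quad_phase w y)) k ->
  0 < a <= b -> b <= 1 / 2 ->
  Cmod (k b - k a) <= 4 / (1 - mu) * (Rpower a (mu - 1) / w).
Proof.
  intros Hmu Hw Hk Hab Hb.
  assert (Hq : 0 < / w) by (apply Rinv_0_lt_compat; lra).
  assert (Hm : 1 < / (1 - mu)).
  { rewrite <- Rinv_1 at 1. apply Rinv_lt_contravar; lra. }
  eapply Rle_trans.
  - apply (quad_primitive_test mu w k (fun y => - (2 / ((1 - mu) * w)) * Rpower y (mu - 1))
      (fun y => - (2 / ((1 - mu) * w)) * ((mu - 1) * Rpower y (mu - 1 - 1))) a b Hw Hk);
      auto; try (intros; lra).
    + intros y Hy. apply is_derive_scal, is_derive_Rpower. lra.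
    + intros y Hy. eapply Rle_trans; [apply Rabs_quad_amplitude'; auto; lra|].
      rewrite (Rpower_shift y (mu - 1)) by lra. rewrite Rabs_left by lra.
      assert (HP : 0 < Rpower y (mu - 1)) by apply exp_pos.
      set (P := Rpower y (mu - 1)) in *.
      replace (- (2 / ((1 - mu) * w)) * ((mu - 1) * (P / y)))
        with (P / w * (2 * / y)) by (field; lra).
      replace (P / (2 * w * - (y - 1)) * (/ y + / - (y - 1)))
        with (P / w * (/ (2 * (1 - y)) * (/ y + / (1 - y)))) by (field; lra).
      apply Rmult_le_compat_l; [apply Rlt_le, Rdiv_lt_0_compat; lra|].
      assert (/ (2 * (1 - y)) <= 1).
      { rewrite <- Rinv_1. apply Rinv_le_contravar; lra. }
      assert (0 < / (2 * (1 - y))) by (apply Rinv_0_lt_compat; lra).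
      assert (0 < / (1 - y)) by (apply Rinv_0_lt_compat; lra).
      assert (/ (1 - y) <= / y) by (apply Rinv_le_contravar; lra).
      nra.
  - assert (Q : forall y, a <= y <= b ->
        Rabs (quad_amplitude mu w y) <= Rpower a (mu - 1) / w).
    { intros y Hy. rewrite Rabs_quad_amplitude, Rabs_left by lra.
      apply Rmult_le_compat.
      - apply Rlt_le, exp_pos.
      - apply Rlt_le, Rinv_0_lt_compat. nra.
      - apply Rpower_decreasing; lra.
      - apply Rinv_le_contravar; nra. }
    pose proof (Q a ltac:(lra)). pose proof (Q b ltac:(lra)).
    assert (0 < Rpower b (mu - 1)) by apply exp_pos.
    assert (HP : 0 < Rpower a (mu - 1)) by apply exp_pos.
    set (P := Rpower a (mu - 1)) in *.
    assert (0 < / (1 - mu) * / w) by (apply Rmult_lt_0_compat; lra).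
    assert (0 < P / w) by (apply Rdiv_lt_0_compat; lra).
    replace (- (2 / ((1 - mu) * w)) * Rpower b (mu - 1) - - (2 / ((1 - mu) * w)) * P)
      with (2 * / (1 - mu) * (P / w) - 2 * (/ (1 - mu) * / w) * Rpower b (mu - 1))
      by (field; lra).
    unfold Rdiv at 3. nra.
Qed.

Lemma quad_increment_trivial (mu w : R) (k : R -> C) (a b : R) :
  0 < mu < 1 -> singular_primitive mu (fun y => expi (quad_phase w y)) k ->
  1 / 2 <= a <= b -> Cmod (k b - k a) <= 2 * (b - a).
Proof.
  intros Hmu [_ [Kc Kd]] Hab. replace (2 * (b - a)) with (2 * b - 2 * a) by ring.
  apply (Cmod_increment_le k (fun x => RtoC (Rpower x (mu - 1)) * expi (quad_phase w x))%C
    (fun x => 2 * x) (fun _ => 2)); try lra; auto.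
  - intros y _. apply (ex_derive_continuous (V := R_NormedModule)). auto_derive. easy.
  - intros y Hy. apply Kd; lra.
  - intros y _. auto_derive; [easy|ring].
  - intros y Hy. rewrite Cmod_nonneg_mult, Cmod_expi, Rmult_1_r by apply Rlt_le, exp_pos.
    apply Rpower_ge_half; lra.
Qed.

(** * Uniform upper bound for the model integral *)

Lemma Rpower_half (w : R) : 0 < w -> Rpower w (- (1 / 2)) = / sqrt w.
Proof.
  intros Hw. rewrite Rpower_Ropp. f_equal. rewrite <- Rpower_sqrt by exact Hw.
  f_equal. lra.
Qed.

(** Trivial bounds on the natural scales around 0 and 1, the first derivative test elsewhere; the
    cuts are placed where the two kinds of bound have the same order. *)
Lemma quad_primitive_bound (mu : R) :
  0 < mu < 1 -> exists B, 0 < B /\ forall w k z, 1 <= w ->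
  singular_primitive mu (fun y => expi (quad_phase w y)) k -> 0 <= z ->
  Cmod (k z) <= B * (Rpower w (- mu) + Rpower w (- (1 / 2))).
Proof.
  intros Hmu.
  assert (Hi : 0 < / mu) by (apply Rinv_0_lt_compat; lra).
  assert (Hj : 0 < / (1 - mu)) by (apply Rinv_0_lt_compat; lra).
  (* 1/mu comes from [0, c], 8/(1-mu) from [c, 1/2], and 18 = 8 + 2 + 8 from the pieces before,
     around and after the stationary point. *)
  exists (/ mu + 8 * / (1 - mu) + 18). split; [lra|]. intros w k z Hw Hk Hz.
  rewrite Rpower_half by lra.
  assert (Hs : 1 <= sqrt w) by (rewrite <- sqrt_1; apply sqrt_le_1; lra).
  assert (Hss : sqrt w * sqrt w = w) by (apply sqrt_sqrt; lra).
  assert (HP : 0 < Rpower w (- mu)) by apply exp_pos.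
  set (P := Rpower w (- mu)) in *. set (s := sqrt w) in *.
  assert (His : 0 < / s) by (apply Rinv_0_lt_compat; lra).
  assert (Hs1 : / s <= 1) by (rewrite <- Rinv_1; apply Rinv_le_contravar; lra).
  assert (Hiw : 0 < / w <= 1).
  { split; [apply Rinv_0_lt_compat; lra|]. rewrite <- Rinv_1. apply Rinv_le_contravar; lra. }
  (* The factors 1/2 keep the cuts ordered for every w >= 1: c <= 1/2 <= 1 - eta. *)
  set (c := / 2 * / w). set (eta := / 2 * / s).
  assert (B1 : forall z, 0 <= z <= c -> Cmod (k z) <= / mu * P).
  { intros y Hy. eapply Rle_trans;
      [apply (singular_primitive_le mu (fun y => expi (quad_phase w y)) k y)|]; try easy; try lra.
    - intros x. rewrite Cmod_expi. lra.
    - unfold Rdiv. rewrite Rmult_comm. apply Rmult_le_compat_l; [lra|].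
      unfold P. rewrite Rpower_Ropp.
      unfold pos_power. destruct (Rlt_dec 0 y).
      + rewrite <- Rpower_Ropp, <- Rpower_inv_base by lra.
        apply Rle_Rpower_l; unfold c in Hy; lra.
      + apply Rlt_le, Rinv_0_lt_compat, exp_pos. }
  assert (Step : forall x y A D, Cmod (k x) <= A -> Cmod (k y - k x) <= D ->
            Cmod (k y) <= A + D).
  { intros x y A D H1 H2. replace (k y) with (k x + (k y - k x))%C by ring.
    eapply Rle_trans; [apply Cmod_triangle|lra]. }
  assert (B2 : forall z, 0 <= z <= 1 / 2 -> Cmod (k z) <= / mu * P + 8 * / (1 - mu) * P).
  { intros y Hy. destruct (Rle_dec y c) as [H|H].
    - specialize (B1 y ltac:(lra)). assert (0 < / (1 - mu) * P) by nra. nra.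
    - apply (Step c); [apply B1; unfold c; lra|].
      eapply Rle_trans; [apply (quad_increment_left mu w); auto; unfold c in *; lra|].
      replace (8 * / (1 - mu) * P) with (4 / (1 - mu) * (2 * P)) by (field; lra).
      apply Rmult_le_compat_l; [unfold Rdiv; lra|].
      unfold c. rewrite <- Rpower_mult_distr by lra.
      replace (Rpower (/ 2) (mu - 1) * Rpower (/ w) (mu - 1) / w)
        with (Rpower (/ 2) (mu - 1) * (Rpower (/ w) (mu - 1) / w)) by (field; lra).
      rewrite (Rpower_inv_base w), <- Rpower_shift by lra.
      replace (- (mu - 1) - 1) with (- mu) by ring.
      apply Rmult_le_compat_r; [lra|]. apply Rpower_ge_half; lra. }
  set (A := / mu * P + 8 * / (1 - mu) * P) in *.
  assert (E8 : 4 / (w * eta) = 8 * / s) by (unfold eta; rewrite <- Hss; field; lra).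
  assert (B3 : forall z, 0 <= z <= 1 - eta -> Cmod (k z) <= A + 8 * / s).
  { intros y Hy. destruct (Rle_dec y (1 / 2)) as [H|H].
    - specialize (B2 y ltac:(lra)). lra.
    - apply (Step (1 / 2)); [apply B2; lra|]. rewrite <- E8.
      apply (quad_increment_away mu w k); auto; unfold eta in *; lra. }
  assert (B4 : forall z, 0 <= z <= 1 + eta -> Cmod (k z) <= A + 8 * / s + 2 * / s).
  { intros y Hy. destruct (Rle_dec y (1 - eta)) as [H|H].
    - specialize (B3 y ltac:(lra)). lra.
    - apply (Step (1 - eta)); [apply B3; unfold eta; lra|].
      eapply Rle_trans; [apply (quad_increment_trivial mu w k); auto; unfold eta in *; lra|].
      unfold eta in *; lra. }
  assert (B5 : Cmod (k z) <= A + 8 * / s + 2 * / s + 8 * / s).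
  { destruct (Rle_dec z (1 + eta)) as [H|H].
    - specialize (B4 z ltac:(lra)). lra.
    - apply (Step (1 + eta)); [apply B4; unfold eta; lra|]. rewrite <- E8.
      apply (quad_increment_away mu w k); auto; unfold eta in *; lra. }
  unfold A in B5. assert (0 < / mu * / s) by nra. assert (0 < / (1 - mu) * / s) by nra.
  nra.
Qed.

(* With [S] the imaginary part, [S x - x^(mu-1) (1 - cos x)] increases since its
   derivative is [(1 - mu) x^(mu-2) (1 - cos x)]. *)
Lemma lin_primitive_lower (mu : R) :
  0 < mu < 1 -> exists c, 0 < c /\ forall E X,
  singular_primitive mu expi E -> 2 <= X -> c <= Cmod (E X).
Proof.
  intros Hmu. pose proof PI2_1 as Hpi.
  assert (Hcos1 : cos 1 < 1).
  { rewrite <- cos_0 at 2. apply cos_decreasing_1; lra. }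
  assert (HP2 : 0 < Rpower 2 (mu - 1)) by apply exp_pos.
  (* A lower bound of [D'] on [1, 2], an interval of length 1, hence of D 2 - D 1. *)
  set (d := (1 - mu) * (Rpower 2 (mu - 1) / 2) * (1 - cos 1)).
  assert (Hd : 0 < d) by (unfold d; apply Rmult_lt_0_compat; nra).
  exists d. split; [exact Hd|]. intros E X [E0 [Ec Ed]] HX.
  set (S := fun x => snd (E x)).
  assert (S0 : S 0 = 0) by (unfold S; now rewrite E0).
  assert (Sc : forall x, continuous S x) by (intros x; now apply Ccontinuous_snd).
  assert (Sd : forall x, 0 < x -> is_derive S x (Rpower x (mu - 1) * sin x)).
  { intros x Hx. evar_last; [apply is_Cderive_snd, Ed, Hx|]. simpl. ring. }
  set (D := fun x => S x - Rpower x (mu - 1) * (1 - cos x)).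
  set (D' := fun x => (1 - mu) * (Rpower x (mu - 1) / x) * (1 - cos x)).
  assert (Dd : forall x, 0 < x -> is_derive D x (D' x)).
  { intros x Hx. unfold D, D'. evar_last.
    - apply @is_derive_minus; [apply Sd, Hx|].
      apply @is_derive_mult; [now apply is_derive_Rpower| |apply Rmult_comm].
      instantiate (1 := sin x). auto_derive; [easy|ring].
    - unfold minus, plus, opp, mult; simpl. rewrite (Rpower_shift x (mu - 1)) by lra. ring. }
  assert (Dc : forall x, 0 < x -> continuous D x).
  { intros x Hx. apply (ex_derive_continuous (V := R_NormedModule)).
    eexists. now apply Dd. }
  (* Below 1 the weight is at least 1 and the sine nonnegative, so [S] dominates 1 - cos there. The
     interval [0, 1] is treated apart because [D] contains the singular power. *)
  assert (D1 : 0 <= D 1).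
  { assert (H : S 0 - (1 - cos 0) <= S 1 - (1 - cos 1)).
    { apply (nondecreasing_of_derive (fun x => S x - (1 - cos x))
        (fun x => Rpower x (mu - 1) * sin x - sin x)); [lra| | |].
      - intros x _. apply (@continuous_minus _ _ R_NormedModule); [apply Sc|].
        apply (ex_derive_continuous (V := R_NormedModule)). auto_derive. easy.
      - intros x Hx. apply @is_derive_minus; [apply Sd; lra|].
        auto_derive; [easy|ring].
      - intros x Hx.
        assert (0 <= sin x) by (apply sin_ge_0; lra).
        assert (1 <= Rpower x (mu - 1)).
        { rewrite <- (Rpower_base_1 (mu - 1)) at 1. apply Rpower_decreasing; lra. }
        nra. }
    rewrite S0, cos_0 in H. unfold D. rewrite Rpower_base_1. lra. }
  assert (D2 : D 1 - d * 1 <= D 2 - d * 2).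
  { apply (nondecreasing_of_derive (fun x => D x - d * x) (fun x => D' x - d)); [lra| | |].
    - intros x Hx. apply (@continuous_minus _ _ R_NormedModule); [apply Dc; lra|].
      apply (ex_derive_continuous (V := R_NormedModule)). auto_derive. easy.
    - intros x Hx. apply @is_derive_minus; [apply Dd; lra|]. auto_derive; [easy|ring].
    - intros x Hx. enough (d <= D' x) by lra. unfold d, D'.
      assert (cos x < cos 1) by (apply cos_decreasing_1; lra).
      assert (Rpower 2 (mu - 1) / 2 <= Rpower x (mu - 1) / x).
      { apply Rmult_le_compat; [lra | lra | apply Rpower_decreasing; lra |].
        apply Rinv_le_contravar; lra. }
      apply Rmult_le_compat; [nra | lra | nra | lra]. }
  assert (DX : D 2 <= D X).
  { apply (nondecreasing_of_derive D D'); [exact HX| | |].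
    - intros x Hx. apply Dc. lra.
    - intros x Hx. apply Dd. lra.
    - intros x Hx. unfold D'. pose proof (COS_bound x).
      apply Rmult_le_pos; [|lra]. apply Rmult_le_pos; [lra|].
      apply Rlt_le, Rdiv_lt_0_compat; [apply exp_pos|lra]. }
  assert (HS : D X <= S X).
  { unfold D. pose proof (COS_bound X).
    assert (0 <= Rpower X (mu - 1) * (1 - cos X)); [|lra].
    apply Rmult_le_pos; [apply Rlt_le, exp_pos|lra]. }
  pose proof (Rmax_Cmod (E X)) as HM.
  pose proof (Rmax_r (Rabs (fst (E X))) (Rabs (snd (E X)))).
  pose proof (Rle_abs (snd (E X))). fold (S X) in *. lra.
Qed.

(** * Asymptotics and lower bound of the model integral at the point 2 *)

Lemma Cmod_expi_sub_1 (a : R) : Cmod (expi a - 1) <= Rabs a.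
Proof.
  assert (P : forall b, 0 <= b -> Cmod (expi b - 1) <= b).
  { intros b Hb.
    replace (RtoC 1) with (expi 0) by (unfold expi; now rewrite cos_0, sin_0).
    replace b with (b - 0) at 2 by ring.
    apply (Cmod_increment_le expi (fun x => Ci * RtoC 1 * expi x)%C (fun x => x)
      (fun _ => 1) 0 b Hb).
    - intros x _. eapply is_Cderive_continuous, (is_Cderive_expi (fun y => y)).
      apply @is_derive_id.
    - intros x _. apply continuous_id.
    - intros x _. apply (is_Cderive_expi (fun y => y)). apply @is_derive_id.
    - intros x _. apply @is_derive_id.
    - intros x _. rewrite !Cmod_mult, Cmod_expi, Cmod_Ci, Cmod_1. lra. }
  destruct (Rle_dec 0 a) as [H|H].
  - rewrite Rabs_pos_eq by exact H. now apply P.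
  - rewrite Rabs_left by lra.
    replace (expi a - 1)%C with (Cconj (expi (- a) - 1)).
    + rewrite Cmod_conj. apply P. lra.
    + unfold Cconj, expi, Cminus, Cplus, Copp, RtoC; simpl.
      rewrite cos_neg, sin_neg. f_equal; ring.
Qed.

(** The difference is (y^mu - y) / y, where y^mu lies between 1 and y and 1/y <= 2. *)
Lemma Rabs_Rpower_sub_1 (mu y : R) :
  0 < mu < 1 -> 1 / 2 <= y -> Rabs (Rpower y (mu - 1) - 1) <= 2 * Rabs (y - 1).
Proof.
  intros Hmu Hy. rewrite Rpower_shift by lra.
  assert (Hi : 0 < / y <= 2).
  { split; [apply Rinv_0_lt_compat; lra|]. replace 2 with (/ (1 / 2)) by field.
    apply Rinv_le_contravar; lra. }
  assert (Hy1 : y * / y = 1) by (apply Rinv_r; lra).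
  unfold Rdiv. destruct (Rle_dec 1 y) as [H|H].
  - assert (1 <= Rpower y mu).
    { rewrite <- (Rpower_base_1 mu). apply Rle_Rpower_l; lra. }
    assert (Rpower y mu <= y).
    { rewrite <- (Rpower_1 y) at 2 by lra. apply Rle_Rpower; lra. }
    rewrite (Rabs_pos_eq (y - 1)) by lra. apply Rabs_le. split; nra.
  - assert (Rpower y mu <= 1).
    { rewrite <- (Rpower_base_1 mu). apply Rle_Rpower_l; lra. }
    assert (y <= Rpower y mu).
    { rewrite <- (Rpower_1 y) at 1 by lra.
      rewrite <- (Rinv_inv y), !(Rpower_inv_base (/ y)) by lra.
      apply Rle_Rpower; nra. }
    rewrite (Rabs_left (y - 1)) by lra. apply Rabs_le. split; nra.
Qed.

(* Near [y = 1], substitute [v = w (y - 1)^2]; [sg] is the sign of [y - 1]. *)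
Lemma is_Cderive_center (mu w sg : R) (k H : R -> C) (y : R) :
  0 < w -> sg * sg = 1 -> 0 < y -> 0 < sg * (y - 1) ->
  singular_primitive mu (fun y => expi (quad_phase w y)) k ->
  singular_primitive (1 / 2) expi H ->
  is_Cderive
    (fun y => k y - RtoC (sg / 2 * / sqrt w) * Cconj (H (w * (y - 1) ^ 2)%R))%C y
    (RtoC (Rpower y (mu - 1) - 1) * expi (quad_phase w y))%C.
Proof.
  intros Hw Hsg Hy Hs [_ [_ Kd]] [_ [_ Hd]].
  assert (Hs2 : sqrt w * sqrt w = w) by (apply sqrt_sqrt; lra).
  assert (Hs0 : 0 < sqrt w) by (apply sqrt_lt_R0; lra).
  assert (Hv : w * (y - 1) ^ 2 = (sqrt w * (sg * (y - 1))) ^ 2).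
  { rewrite <- Hs2 at 1. transitivity (sqrt w * sqrt w * (y - 1) ^ 2 * (sg * sg));
      [rewrite Hsg; ring | ring]. }
  assert (Hb : 0 < sqrt w * (sg * (y - 1))) by nra.
  assert (Hv0 : 0 < w * (y - 1) ^ 2) by (rewrite Hv; nra).
  assert (E : Rpower (w * (y - 1) ^ 2) (1 / 2 - 1) = / (sqrt w * (sg * (y - 1)))).
  { replace (1 / 2 - 1) with (- (1 / 2)) by field. rewrite Rpower_half by exact Hv0.
    rewrite Hv, sqrt_pow2 by lra. reflexivity. }
  evar_last.
  - apply is_Cderive_minus; [apply Kd, Hy|]. apply is_Cderive_cmult, is_Cderive_conj.
    apply (is_Cderive_comp H (fun y => w * (y - 1) ^ 2)); [apply Hd, Hv0|].
    instantiate (1 := 2 * w * (y - 1)). auto_derive; [easy|ring].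
  - rewrite E. unfold quad_phase.
    (* The Jacobian of the substitution cancels the prefactor, so the subtracted term is a primitive
       of the unweighted oscillation; the conjugate accounts for the minus sign in [quad_phase]. *)
    assert (F : sg / 2 * / sqrt w * (2 * w * (y - 1) * / (sqrt w * (sg * (y - 1)))) = 1).
    { clear E Hb Hv. revert Hs0 Hs2. generalize (sqrt w). intros s Hs0 Hs2.
      rewrite <- Hs2. field. repeat split; nra. }
    set (a := / (sqrt w * (sg * (y - 1)))) in *. set (b := sg / 2 * / sqrt w) in *.
    set (m := 2 * w * (y - 1)) in *. set (P := Rpower y (mu - 1)).
    set (th := w * (y - 1) ^ 2).
    unfold expi, Cconj, Cminus, Cplus, Copp, Cmult, RtoC; simpl.
    rewrite cos_neg, sin_neg. f_equal.
    + replace ((P - 1) * cos th - 0 * - sin th) with (P * cos th - 1 * cos th) by ring.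
      rewrite <- F. ring.
    + replace ((P - 1) * - sin th + 0 * cos th) with (- P * sin th + 1 * sin th) by ring.
      rewrite <- F. ring.
Qed.

(** The weight is replaced by its value 1 at the stationary point, at the cost of 2 eta per unit
    length over a length 2 eta. The two sides of 1 are separate because [sg] changes; each
    contributes half of the Fresnel term, and [H 0 = 0] joins them. *)
Lemma quad_increment_center (mu w eta : R) (k H : R -> C) :
  0 < mu < 1 -> 0 < w -> 0 < eta <= 1 / 2 ->
  singular_primitive mu (fun y => expi (quad_phase w y)) k ->
  singular_primitive (1 / 2) expi H ->
  Cmod (k (1 + eta) - k (1 - eta)
        - RtoC (/ sqrt w) * Cconj (H (w * eta ^ 2)%R)) <= 4 * eta ^ 2.
Proof.
  intros Hmu Hw Heta Hk HH.
  set (f := fun sg y =>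
    (k y - RtoC (sg / 2 * / sqrt w) * Cconj (H (w * (y - 1) ^ 2)%R))%C).
  assert (B : forall sg a b, sg * sg = 1 -> 1 - eta <= a <= b -> b <= 1 + eta ->
     (forall y, a < y < b -> 0 < sg * (y - 1)) ->
     Cmod (f sg b - f sg a) <= 2 * eta * b - 2 * eta * a).
  { intros sg a b Hsg Ha Hb Hy.
    apply (Cmod_increment_le (f sg)
      (fun y => RtoC (Rpower y (mu - 1) - 1) * expi (quad_phase w y))%C
      (fun y => 2 * eta * y) (fun _ => 2 * eta)); [lra| | | | |].
    - intros y _. destruct Hk as [_ [Kc _]], HH as [_ [Hc _]].
      unfold f. apply Ccontinuous_minus; [apply Kc|].
      apply Ccontinuous_mult; [apply Ccontinuous_const|].
      assert (G : Ccontinuous (fun y => H (w * (y - 1) ^ 2)) y).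
      { apply (Ccontinuous_comp H (fun y => w * (y - 1) ^ 2)); [|apply Hc].
        apply (ex_derive_continuous (V := R_NormedModule)). auto_derive. easy. }
      apply Ccontinuous_pair; simpl.
      + apply (Ccontinuous_fst _ _ G).
      + apply (@continuous_opp _ _ R_NormedModule), (Ccontinuous_snd _ _ G).
    - intros y _. apply (ex_derive_continuous (V := R_NormedModule)). auto_derive. easy.
    - intros y Hy'. apply is_Cderive_center; auto; lra.
    - intros y _. auto_derive; [easy|ring].
    - intros y Hy'. rewrite Cmod_mult, Cmod_R, Cmod_expi, Rmult_1_r.
      eapply Rle_trans; [apply Rabs_Rpower_sub_1; lra|].
      assert (Rabs (y - 1) <= eta) by (apply Rabs_le; lra). lra. }
  pose proof (B 1 1 (1 + eta) ltac:(ring) ltac:(lra) ltac:(lra) ltac:(intros; lra)) as B1.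
  pose proof (B (-1) (1 - eta) 1 ltac:(ring) ltac:(lra) ltac:(lra) ltac:(intros; lra)) as B2.
  destruct HH as [H0 _].
  match goal with |- Cmod ?z <= _ =>
    replace z with ((f 1%R (1 + eta)%R - f 1%R 1%R)
       + (f (-1)%R 1%R - f (-1)%R (1 - eta)%R))%C end.
  - eapply Rle_trans; [apply Cmod_triangle|]. lra.
  - unfold f.
    replace (w * (1 + eta - 1) ^ 2) with (w * eta ^ 2) by ring.
    replace (w * (1 - eta - 1) ^ 2) with (w * eta ^ 2) by ring.
    replace (w * (1 - 1) ^ 2) with 0 by ring. rewrite H0.
    set (h := H (w * eta ^ 2)). set (s := / sqrt w).
    unfold Cconj, Cminus, Cplus, Copp, Cmult, RtoC; simpl. f_equal; field.
Qed.

(** Near 0 the phase is -w + 2 w y - w y^2. Dropping the last term changes the exponential by at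
    most w eta^2, and the substitution 2 w y turns the rest into [E]. *)
Lemma quad_primitive_left_end (mu w eta : R) (k E : R -> C) :
  0 < mu < 1 -> 0 < w -> 0 < eta <= 1 ->
  singular_primitive mu (fun y => expi (quad_phase w y)) k ->
  singular_primitive mu expi E ->
  Cmod (k eta - expi (- w) * RtoC (Rpower (2 * w) (- mu)) * E (2 * w * eta)%R)
  <= w * eta ^ 2 / mu.
Proof.
  intros Hmu Hw Heta [K0 [Kc Kd]] [E0 [Ec Ed]].
  set (c := (expi (- w) * RtoC (Rpower (2 * w) (- mu)))%C).
  set (f := fun y => (k y - c * E (2 * w * y)%R)%C).
  assert (F0 : f 0 = 0%C) by (unfold f; rewrite Rmult_0_r, K0, E0; ring).
  replace (k eta - c * E (2 * w * eta)%R)%C with (f eta - f 0)%C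
    by (rewrite F0; unfold f; ring).
  apply Rle_trans with (w * eta ^ 2 / mu * pos_power mu eta
                        - w * eta ^ 2 / mu * pos_power mu 0).
  - apply (Cmod_increment_le f
      (fun y => RtoC (Rpower y (mu - 1)) *
         (expi (2 * w * y - w) * (expi (- (w * y ^ 2)) - 1)))%C
      (fun y => w * eta ^ 2 / mu * pos_power mu y)
      (fun y => w * eta ^ 2 / mu * (mu * Rpower y (mu - 1)))); [lra| | | | |].
    + intros y _. unfold f. apply Ccontinuous_minus; [apply Kc|].
      apply Ccontinuous_mult; [apply Ccontinuous_const|].
      apply (Ccontinuous_comp E (fun y => 2 * w * y)); [|apply Ec].
      apply (ex_derive_continuous (V := R_NormedModule)). auto_derive. easy.
    + intros y _. apply (@continuous_mult _ R_AbsRing); [apply continuous_const|].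
      apply continuous_pos_power; lra.
    + intros y Hy. unfold f. evar_last.
      * apply is_Cderive_minus; [apply Kd; lra|]. apply is_Cderive_cmult.
        apply (is_Cderive_comp E (fun y => 2 * w * y)); [apply Ed; nra|].
        instantiate (1 := 2 * w). auto_derive; [easy|ring].
      * unfold c. rewrite <- (Rpower_mult_distr (2 * w) y), (Rpower_shift (2 * w)) by lra.
        replace (quad_phase w y) with ((2 * w * y + - w) + - (w * y ^ 2))
          by (unfold quad_phase; ring).
        replace (2 * w * y - w) with (2 * w * y + - w) by ring.
        rewrite !expi_plus.
        assert (G : Rpower (2 * w) (- mu) * (2 * w * (Rpower (2 * w) mu / (2 * w))) = 1).
        { rewrite Rpower_Ropp. field.
          split; [lra | apply Rgt_not_eq, exp_pos]. }
        set (P := Rpower y (mu - 1)). set (a := Rpower (2 * w) (- mu)) in *.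
        set (b := Rpower (2 * w) mu / (2 * w)) in *. set (m := 2 * w) in *.
        transitivity (RtoC P * expi (m * y) * expi (- w) *
          (expi (- (w * y ^ 2)) - RtoC (a * (m * b))))%C.
        -- rewrite !RtoC_mult. ring.
        -- rewrite G. ring.
    + intros y Hy. apply is_derive_scal, is_derive_pos_power. lra.
    + intros y Hy. rewrite Cmod_nonneg_mult by apply Rlt_le, exp_pos.
      rewrite Cmod_mult, Cmod_expi, Rmult_1_l.
      replace (w * eta ^ 2 / mu * (mu * Rpower y (mu - 1)))
        with (Rpower y (mu - 1) * (w * eta ^ 2)) by (field; lra).
      apply Rmult_le_compat_l; [apply Rlt_le, exp_pos|].
      eapply Rle_trans; [apply Cmod_expi_sub_1|].
      rewrite Rabs_Ropp, Rabs_pos_eq by nra.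
      apply Rmult_le_compat_l; [lra|]. apply pow_incr. lra.
  - rewrite pos_power_0, Rmult_0_r, Rminus_0_r, pos_power_eq by lra.
    rewrite <- (Rmult_1_r (w * eta ^ 2 / mu)) at 2.
    apply Rmult_le_compat_l.
    + apply Rdiv_le_0_compat; [nra|lra].
    + rewrite <- (Rpower_base_1 mu). apply Rle_Rpower_l; lra.
Qed.

(** Cut at e1, 1/2, 1 - e2 and 1 + e2. The main terms come from [0, e1] and from around 1; the first
    line of the bound collects the three non-stationary pieces, the second the approximation errors
    w e1^2 / mu and 4 e2^2. *)
Lemma quad_primitive_asymptotics (mu w X : R) (k E H : R -> C) :
  0 < mu < 1 -> 0 < X -> 4 * X <= w ->
  singular_primitive mu (fun y => expi (quad_phase w y)) k ->
  singular_primitive mu expi E -> singular_primitive (1 / 2) expi H ->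
  Cmod (k 2 - (RtoC (/ sqrt w) * Cconj (H X)
               + expi (- w) * RtoC (Rpower (2 * w) (- mu)) * E X))
  <= 8 / (1 - mu) * (/ sqrt X * / sqrt w + Rpower X (mu - 1) * Rpower w (- mu))
     + (4 * X + X ^ 2 / (4 * mu)) * / w.
Proof.
  intros Hmu HX Hw Hk HE HH.
  (* Chosen so that 2 w e1 = w e2^2 = X: both special functions are then evaluated at the same fixed
     point. *)
  set (e1 := X / (2 * w)). set (e2 := sqrt (X / w)).
  assert (Hiw : 0 < / w) by (apply Rinv_0_lt_compat; lra).
  assert (Hwi : w * / w = 1) by (apply Rinv_r; lra).
  assert (HXw : 0 < X / w <= 1 / 4).
  { split; [apply Rdiv_lt_0_compat; lra|]. unfold Rdiv. nra. }
  assert (He1 : 0 < e1 <= 1 / 8).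
  { replace e1 with (/ 2 * (X / w)) by (unfold e1; field; lra). lra. }
  assert (He2s : e2 ^ 2 = X / w) by (unfold e2; rewrite pow2_sqrt; lra).
  assert (He2 : 0 < e2 <= 1 / 2).
  { split; [apply sqrt_lt_R0; lra|]. unfold e2.
    replace (1 / 2) with (sqrt ((1 / 2) ^ 2)) by (apply sqrt_pow2; lra).
    apply sqrt_le_1; lra. }
  pose proof (quad_primitive_left_end mu w e1 k E Hmu ltac:(lra) ltac:(lra) Hk HE) as A1.
  pose proof (quad_increment_left mu w k e1 (1 / 2) Hmu ltac:(lra) Hk ltac:(lra)
    ltac:(lra)) as A2.
  pose proof (quad_increment_away mu w k (1 / 2) (1 - e2) e2 Hmu ltac:(lra) Hk ltac:(lra)
    ltac:(lra) ltac:(lra)) as A3.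
  pose proof (quad_increment_center mu w e2 k H Hmu ltac:(lra) ltac:(lra) Hk HH) as A4.
  pose proof (quad_increment_away mu w k (1 + e2) 2 e2 Hmu ltac:(lra) Hk ltac:(lra)
    ltac:(lra) ltac:(lra)) as A5.
  replace (2 * w * e1) with X in A1 by (unfold e1; field; lra).
  replace (w * e2 ^ 2) with X in A4 by (rewrite He2s; field; lra).
  set (cE := (expi (- w) * RtoC (Rpower (2 * w) (- mu)) * E X)%C) in *.
  set (cH := (RtoC (/ sqrt w) * Cconj (H X))%C) in *.
  replace (k 2 - (cH + cE))%C with
    ((k 2 - k (1 + e2)%R) + ((k (1 + e2)%R - k (1 - e2)%R - cH)
     + ((k (1 - e2)%R - k (1 / 2)%R) + ((k (1 / 2)%R - k e1) + (k e1 - cE)))))%C by ring.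
  assert (T : forall a b x y, Cmod a <= x -> Cmod b <= y -> Cmod (a + b) <= x + y).
  { intros a b x y H1 H2. eapply Rle_trans; [apply Cmod_triangle|lra]. }
  eapply Rle_trans; [exact (T _ _ _ _ A5 (T _ _ _ _ A4 (T _ _ _ _ A3 (T _ _ _ _ A2 A1))))|].
  rewrite He2s.
  assert (E1 : 4 / (w * e2) = 4 * (/ sqrt X * / sqrt w)).
  { assert (0 < sqrt X) by (apply sqrt_lt_R0; lra).
    assert (0 < sqrt w) by (apply sqrt_lt_R0; lra).
    unfold e2. rewrite sqrt_div by lra. rewrite <- (sqrt_sqrt w) at 1 by lra.
    field. split; lra. }
  assert (E2 : Rpower e1 (mu - 1) / w <= 2 * (Rpower X (mu - 1) * Rpower w (- mu))).
  { replace e1 with (/ 2 * (X * / w)) by (unfold e1; field; lra).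
    rewrite <- !Rpower_mult_distr by (try apply Rmult_lt_0_compat; lra).
    rewrite (Rpower_inv_base w) by lra.
    replace (- mu) with (- (mu - 1) - 1) by ring. rewrite (Rpower_shift w) by lra.
    assert (Rpower (/ 2) (mu - 1) <= 2) by (apply Rpower_ge_half; lra).
    assert (0 < Rpower X (mu - 1) * (Rpower w (- (mu - 1)) / w)).
    { apply Rmult_lt_0_compat; [apply exp_pos|].
      apply Rdiv_lt_0_compat; [apply exp_pos|lra]. }
    unfold Rdiv in *. nra. }
  assert (E3 : w * e1 ^ 2 / mu = X ^ 2 / (4 * mu) * / w)
    by (unfold e1; field; lra).
  rewrite E1, E3.
  assert (Hm : 1 < / (1 - mu)).
  { rewrite <- Rinv_1 at 1. apply Rinv_lt_contravar; lra. }
  assert (0 < / sqrt X * / sqrt w).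
  { apply Rmult_lt_0_compat; apply Rinv_0_lt_compat, sqrt_lt_R0; lra. }
  assert (4 / (1 - mu) * (Rpower e1 (mu - 1) / w)
    <= 8 / (1 - mu) * (Rpower X (mu - 1) * Rpower w (- mu))).
  { replace (8 / (1 - mu)) with (4 / (1 - mu) * 2) by (field; lra).
    rewrite Rmult_assoc. apply Rmult_le_compat_l; [unfold Rdiv; lra|exact E2]. }
  unfold Rdiv in *. nra.
Qed.

Lemma Rpower_small (p eta : R) :
  0 < p -> 0 < eta -> exists W, 1 <= W /\ forall w, W <= w -> Rpower w (- p) <= eta.
Proof.
  intros Hp He. exists (Rmax 1 (Rpower eta (- / p))). split; [apply Rmax_l|].
  intros w Hw. pose proof (Rmax_r 1 (Rpower eta (- / p))).
  pose proof (Rmax_l 1 (Rpower eta (- / p))).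
  apply Rle_trans with (Rpower (Rpower eta (- / p)) (- p)).
  - apply Rpower_decreasing; [lra|]. split; [apply exp_pos|lra].
  - rewrite Rpower_mult. replace (- / p * - p) with 1 by (field; lra).
    rewrite Rpower_1; lra.
Qed.

Lemma quad_primitive_lower (mu : R) :
  0 < mu < 1 -> exists c W, 0 < c /\ 1 <= W /\ forall w k, W <= w ->
  singular_primitive mu (fun y => expi (quad_phase w y)) k ->
  c * Rpower w (- Rmin mu (1 / 2)) <= Cmod (k 2).
Proof.
  intros Hmu. set (m := Rmin mu (1 / 2)).
  destruct (lin_primitive_exists mu ltac:(lra)) as [E HE].
  destruct (lin_primitive_exists (1 / 2) ltac:(lra)) as [H HH].
  destruct (lin_primitive_lower mu Hmu) as [cE [HcE LE]].
  destruct (lin_primitive_lower (1 / 2) ltac:(lra)) as [cH [HcH LH]].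
  set (A := 8 / (1 - mu)).
  assert (HA : 0 < A) by (apply Rdiv_lt_0_compat; lra).
  (* Fixes [X]: the error terms that do not gain a power of [w] become a small fraction of the main
     terms, uniformly in [w]. *)
  assert (HX : forall eta, 0 < eta -> exists X, 2 <= X /\
             A * Rpower X (- (1 / 2)) <= eta /\ A * Rpower X (mu - 1) <= eta).
  { intros eta He.
    assert (He' : 0 < eta / A) by (apply Rdiv_lt_0_compat; lra).
    destruct (Rpower_small (1 / 2) (eta / A) ltac:(lra) He') as [X1 [_ P1]].
    destruct (Rpower_small (1 - mu) (eta / A) ltac:(lra) He') as [X2 [_ P2]].
    exists (Rmax 2 (Rmax X1 X2)).
    pose proof (Rmax_l 2 (Rmax X1 X2)). pose proof (Rmax_r 2 (Rmax X1 X2)).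
    pose proof (Rmax_l X1 X2). pose proof (Rmax_r X1 X2).
    replace eta with (A * (eta / A)) by (field; lra).
    split; [assumption|]. replace (mu - 1) with (- (1 - mu)) by ring.
    split; (apply Rmult_le_compat_l; [lra|]); [apply P1|apply P2]; lra. }
  (* With [X] frozen, every remaining term gains a factor w^(-p) and is absorbed for large [w],
     however large its coefficient. *)
  assert (Fin : forall d M p W0, 0 < d -> 0 < M -> 0 < p ->
    (forall w k, W0 <= w -> 1 <= w ->
       singular_primitive mu (fun y => expi (quad_phase w y)) k ->
       d * Rpower w (- m) - M * Rpower w (- m - p) <= Cmod (k 2)) ->
    exists c W, 0 < c /\ 1 <= W /\ forall w k, W <= w ->
    singular_primitive mu (fun y => expi (quad_phase w y)) k ->
    c * Rpower w (- m) <= Cmod (k 2)).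
  { intros d M p W0 Hd HM Hp L.
    destruct (Rpower_small p (d / (2 * M)) Hp) as [W1 [HW1 S]].
    { apply Rdiv_lt_0_compat; lra. }
    exists (d / 2), (Rmax W0 W1).
    pose proof (Rmax_l W0 W1). pose proof (Rmax_r W0 W1).
    split; [lra|]. split; [lra|]. intros w k Hw Hk.
    eapply Rle_trans; [|apply (L w k); auto; lra].
    specialize (S w ltac:(lra)).
    unfold Rminus at 2. rewrite Rpower_plus.
    assert (HQ : 0 < Rpower w (- m)) by apply exp_pos.
    assert (M * Rpower w (- p) <= d / 2).
    { replace (d / 2) with (M * (d / (2 * M))) by (field; lra).
      apply Rmult_le_compat_l; lra. }
    nra. }
  (* The primitive of order 1/2 is left free so that, when mu = 1/2, it can be taken to be [E]
     itself, making the two main moduli comparable. *)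
  assert (Asym : forall X w k, 2 <= X -> 4 * X <= w ->
    singular_primitive mu (fun y => expi (quad_phase w y)) k -> forall H',
    singular_primitive (1 / 2) expi H' ->
    exists zE zH, Cmod zE = Rpower 2 (- mu) * Rpower w (- mu) * Cmod (E X) /\
      Cmod zH = Rpower w (- (1 / 2)) * Cmod (H' X) /\
      Cmod (k 2 - (zH + zE)) <=
      A * (Rpower X (- (1 / 2)) * Rpower w (- (1 / 2)) + Rpower X (mu - 1) * Rpower w (- mu))
      + (4 * X + X ^ 2 / (4 * mu)) * Rpower w (-1)).
  { intros X w k HX2 Hw Hk H' HH'.
    eexists. eexists. split; [|split].
    3: { replace (-1) with (- (1)) by ring. rewrite (Rpower_Ropp w 1), Rpower_1 by lra.
         rewrite !Rpower_half by lra.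
         apply (quad_primitive_asymptotics mu w X k E H'); auto; lra. }
    - rewrite !Cmod_mult, Cmod_expi, Rmult_1_l, Cmod_R.
      rewrite Rabs_pos_eq by apply Rlt_le, exp_pos.
      now rewrite Rpower_mult_distr by lra.
    - rewrite Cmod_mult, Cmod_conj, Cmod_R, Rpower_half by lra.
      rewrite Rabs_pos_eq; [reflexivity|].
      apply Rlt_le, Rinv_0_lt_compat, sqrt_lt_R0. lra. }
  assert (Tri : forall a b z, Cmod a - Cmod b - Cmod (z - (a + b)) <= Cmod z).
  { intros a b z. pose proof (Cmod_triangle_inv (a + b) (z - (a + b))) as T1.
    pose proof (Cmod_triangle_inv a b) as T2.
    replace ((a + b) + (z - (a + b)))%C with z in T1 by ring. lra. }
  assert (H2mu : 1 / 2 <= Rpower 2 (- mu) <= 1).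
  { split; [|apply Rpower_le_1; lra].
    replace (1 / 2) with (Rpower 2 (- (1))) by (rewrite Rpower_Ropp, Rpower_1; lra).
    apply Rle_Rpower; lra. }
  destruct (Rtotal_order mu (1 / 2)) as [Hc | [Hc | Hc]].
  - assert (Em : m = mu) by (apply Rmin_left; lra).
    destruct (HX (cE / 4) ltac:(lra)) as [X [HX2 [_ SX]]].
    set (B := 4 * X + X ^ 2 / (4 * mu)) in *.
    assert (HB : 0 < B).
    { unfold B. assert (0 < X ^ 2 / (4 * mu)) by (apply Rdiv_lt_0_compat; nra). lra. }
    set (P := Rpower X (- (1 / 2))) in *.
    assert (HP : 0 < P) by apply exp_pos.
    apply (Fin (cE / 4) (Cmod (H X) + A * P + B) (1 / 2 - mu) (4 * X));
      [lra | pose proof (Cmod_ge_0 (H X)); nra | lra |].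
    intros w k Hw Hw1 Hk.
    destruct (Asym X w k HX2 Hw Hk H HH) as [zE [zH [NE [NH Err]]]].
    specialize (LE E X HE HX2).
    assert (Hb : 0 < Rpower w (- mu)) by apply exp_pos.
    assert (Hab : Rpower w (-1) <= Rpower w (- (1 / 2))) by (apply Rle_Rpower; lra).
    pose proof (Tri zE zH (k 2)) as T. rewrite (Cplus_comm zE zH) in T.
    rewrite Em. replace (- mu - (1 / 2 - mu)) with (- (1 / 2)) by ring.
    rewrite NE, NH in T.
    set (a := Rpower w (- (1 / 2))) in *. set (b := Rpower w (- mu)) in *.
    fold P B in Err. set (Q := Rpower X (mu - 1)) in *.
    assert (cE / 2 * b <= Rpower 2 (- mu) * b * Cmod (E X)).
    { apply Rle_trans with (1 / 2 * b * cE); [lra|].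
      apply Rmult_le_compat; nra. }
    assert (A * (Q * b) <= cE / 4 * b).
    { rewrite <- Rmult_assoc. apply Rmult_le_compat_r; lra. }
    assert (B * Rpower w (-1) <= B * a) by (apply Rmult_le_compat_l; lra).
    lra.
  - assert (Em : m = 1 / 2) by (unfold m; rewrite Rmin_left; lra).
    assert (HS : Rpower 2 (- mu) < 1).
    { rewrite <- (Rpower_O 2) by lra. apply Rpower_lt; lra. }
    set (s := Rpower 2 (- mu)) in *.
    (* The main terms have moduli n w^(-1/2) and s n w^(-1/2) with the same n >= cH and s < 1, so
       they cannot cancel: (1 - s) cH remains. The two errors take a quarter of it each. *)
    destruct (HX ((1 - s) * cH / 4) ltac:(nra)) as [X [HX2 [SX1 SX2]]].
    set (B := 4 * X + X ^ 2 / (4 * mu)) in *.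
    assert (HB : 0 < B).
    { unfold B. assert (0 < X ^ 2 / (4 * mu)) by (apply Rdiv_lt_0_compat; nra). lra. }
    apply (Fin ((1 - s) * cH / 2) B (1 / 2) (4 * X)); [nra | lra | lra |].
    intros w k Hw Hw1 Hk.
    assert (HE' : singular_primitive (1 / 2) expi E) by (now rewrite <- Hc).
    destruct (Asym X w k HX2 Hw Hk E HE') as [zE [zH [NE [NH Err]]]].
    specialize (LH E X HE' HX2).
    pose proof (Tri zH zE (k 2)) as T.
    rewrite NE, NH in T. fold B in Err.
    rewrite Em. replace (- (1 / 2) - 1 / 2) with (-1) by field.
    assert (Hb : 0 < Rpower w (- (1 / 2))) by apply exp_pos.
    replace (Rpower w (- mu)) with (Rpower w (- (1 / 2))) in T, Err
      by (now rewrite Hc).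
    set (a := Rpower w (- (1 / 2))) in *. set (n := Cmod (E X)) in *.
    set (P := Rpower X (- (1 / 2))) in *. set (Q := Rpower X (mu - 1)) in *.
    assert (0 <= (1 - s) * a * (n - cH)) by (repeat apply Rmult_le_pos; lra).
    assert (A * (P * a) <= (1 - s) * cH / 4 * a).
    { rewrite <- Rmult_assoc. apply Rmult_le_compat_r; lra. }
    assert (A * (Q * a) <= (1 - s) * cH / 4 * a).
    { rewrite <- Rmult_assoc. apply Rmult_le_compat_r; lra. }
    lra.
  - assert (Em : m = 1 / 2) by (apply Rmin_right; lra).
    destruct (HX (cH / 4) ltac:(lra)) as [X [HX2 [SX _]]].
    set (B := 4 * X + X ^ 2 / (4 * mu)) in *.
    assert (HB : 0 < B).
    { unfold B. assert (0 < X ^ 2 / (4 * mu)) by (apply Rdiv_lt_0_compat; nra). lra. }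
    set (Q := Rpower X (mu - 1)) in *.
    assert (HQ : 0 < Q) by apply exp_pos.
    apply (Fin (cH / 4) (Cmod (E X) + A * Q + B) (mu - 1 / 2) (4 * X));
      [lra | pose proof (Cmod_ge_0 (E X)); nra | lra |].
    intros w k Hw Hw1 Hk.
    destruct (Asym X w k HX2 Hw Hk H HH) as [zE [zH [NE [NH Err]]]].
    specialize (LH H X HH HX2).
    assert (Ha : 0 < Rpower w (- (1 / 2))) by apply exp_pos.
    assert (Hb : 0 < Rpower w (- mu)) by apply exp_pos.
    assert (Hab : Rpower w (-1) <= Rpower w (- mu)) by (apply Rle_Rpower; lra).
    pose proof (Tri zH zE (k 2)) as T.
    rewrite Em. replace (- (1 / 2) - (mu - 1 / 2)) with (- mu) by ring.
    rewrite NE, NH in T.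
    set (a := Rpower w (- (1 / 2))) in *. set (b := Rpower w (- mu)) in *.
    fold Q B in Err. set (P := Rpower X (- (1 / 2))) in *.
    assert (cH * a <= a * Cmod (H X)) by nra.
    assert (Rpower 2 (- mu) * b * Cmod (E X) <= b * Cmod (E X)).
    { apply Rmult_le_compat_r; [apply Cmod_ge_0|]. nra. }
    assert (A * (P * a) <= cH / 4 * a).
    { rewrite <- Rmult_assoc. apply Rmult_le_compat_r; lra. }
    assert (B * Rpower w (-1) <= B * b) by (apply Rmult_le_compat_l; lra).
    assert (0 < cH * a) by nra.
    lra.
Qed.

(** * The solution in terms of the model integral *)

(** The integrand may blow up at the endpoints; only the primitive has to be continuous there. This
    is where the improper integral defining the solution gets its value. *)
Lemma is_RInt_gen_primitive (H h : R -> C) (a b : R) :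
  a < b -> Ccontinuous H a -> Ccontinuous H b ->
  (forall x, a < x < b -> is_Cderive H x (h x)) ->
  (forall x, a < x < b -> Ccontinuous h x) ->
  is_RInt_gen (V := C_R_NormedModule) h (at_right a) (at_left b) (H b - H a)%C.
Proof.
  intros Hab Ha Hb Hd Hc P HP.
  assert (Lim : filterlim (fun ab : R * R => minus (H (snd ab) : C_R_NormedModule) (H (fst ab)))
            (filter_prod (at_right a) (at_left b))
            (locally (minus (H b : C_R_NormedModule) (H a)))).
  { apply (filterlim_comp_2 (fun ab : R * R => (H (snd ab) : C_R_NormedModule))
      (fun ab : R * R => opp (H (fst ab) : C_R_NormedModule)) plus
      (G := locally (H b : C_R_NormedModule))
      (H := locally (opp (H a : C_R_NormedModule)))).
    - apply (filterlim_comp _ _ _ snd H _ (at_left b)); [apply filterlim_snd|].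
      apply (filterlim_filter_le_1 (G := at_left b) (F := locally b)); [|exact Hb].
      apply filter_le_within.
    - apply (filterlim_comp _ _ _ fst (fun x => opp (H x : C_R_NormedModule))
        _ (at_right a)); [apply filterlim_fst|].
      apply (filterlim_filter_le_1 (G := at_right a) (F := locally a));
        [apply filter_le_within|].
      exact (@continuous_opp R_UniformSpace R_AbsRing C_R_NormedModule H a Ha).
    - apply (filterlim_plus (V := C_R_NormedModule)). }
  specialize (Lim P HP). unfold filtermap in Lim. unfold filtermapi.
  (* Eventually both limits of integration lie in (a, b), in either order, and the ordinary
     fundamental theorem applies. *)
  assert (Hin : filter_prod (at_right a) (at_left b)
            (fun ab => (a < fst ab < b) /\ (a < snd ab < b))).
  { apply (Filter_prod _ _ _ (fun x => a < x < b) (fun x => a < x < b)).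
    - assert (He : 0 < b - a) by lra. exists (mkposreal _ He). intros y Hy Hay.
      unfold ball in Hy; simpl in Hy; unfold AbsRing_ball, abs, minus, plus, opp in Hy.
      simpl in Hy. apply Rabs_def2 in Hy. lra.
    - assert (He : 0 < b - a) by lra. exists (mkposreal _ He). intros y Hy Hay.
      unfold ball in Hy; simpl in Hy; unfold AbsRing_ball, abs, minus, plus, opp in Hy.
      simpl in Hy. apply Rabs_def2 in Hy. lra.
    - intros x y Hx Hy. simpl. auto. }
  generalize (filter_and _ _ Lim Hin). apply filter_imp.
  intros [x y] [H1 [Hx Hy]]. simpl in *. eexists. split; [|exact H1].
  assert (In : forall z, Rmin x y <= z <= Rmax x y -> a < z < b).
  { intros z [Hz1 Hz2]. split.
    - eapply Rlt_le_trans; [|exact Hz1]. apply Rmin_glb_lt; lra.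
    - eapply Rle_lt_trans; [exact Hz2|]. apply Rmax_lub_lt; lra. }
  apply (is_RInt_derive (V := C_R_CompleteNormedModule)).
  - intros z Hz. apply Hd, In, Hz.
  - intros z Hz. apply Hc, In, Hz.
Qed.

Lemma Cprimitive_exists (h : R -> C) :
  (forall x, Ccontinuous h x) ->
  exists W, W 0 = RtoC 0 /\ forall x, is_Cderive W x (h x).
Proof.
  intros Hh. exists (fun x => RInt (V := C_R_CompleteNormedModule) h 0 x). split.
  - apply (RInt_point (V := C_R_CompleteNormedModule)).
  - intros x. apply (is_derive_RInt (V := C_R_NormedModule) h _ 0).
    + apply filter_forall. intros b. apply (RInt_correct (V := C_R_CompleteNormedModule) h).
      apply (ex_RInt_continuous (V := C_R_CompleteNormedModule) h). intros; apply Hh.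
    + apply Hh.
Qed.

(** The retraction onto [0, L]. Composition with it turns continuity relative to the segment into
    continuity on the whole line. *)
Definition clamp (L s : R) : R := Rmax 0 (Rmin L s).

Lemma clamp_bounds (L s : R) : 0 <= L -> 0 <= clamp L s <= L.
Proof.
  intros HL. unfold clamp. split; [apply Rmax_l|]. apply Rmax_lub; [lra|apply Rmin_l].
Qed.

Lemma clamp_id (L s : R) : 0 <= s <= L -> clamp L s = s.
Proof.
  intros Hs. unfold clamp. rewrite Rmin_right by lra. apply Rmax_right. lra.
Qed.

Lemma Rabs_clamp_sub (L s t : R) : 0 <= L -> Rabs (clamp L s - clamp L t) <= Rabs (s - t).
Proof.
  intros HL. unfold clamp, Rmin. destruct (Rle_dec L s), (Rle_dec L t);
  unfold Rmax;
  repeat match goal with |- context [Rle_dec ?a ?b] => destruct (Rle_dec a b) end;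
  unfold Rabs;
  repeat match goal with |- context [Rcase_abs ?a] => destruct (Rcase_abs a) end; lra.
Qed.

Lemma continuous_clamp_comp (h : R -> C) (a L s : R) :
  0 <= L ->
  (forall p, a <= p <= a + L -> filterlim h (within (fun q => a <= q <= a + L) (locally p))
     (locally (h p : C_R_NormedModule))) ->
  Ccontinuous (fun s => h (a + clamp L s)) s.
Proof.
  intros HL Hh. pose proof (clamp_bounds L s HL).
  apply (filterlim_comp _ _ _ (fun s => a + clamp L s) h _
    (within (fun q => a <= q <= a + L) (locally (a + clamp L s)))); [|apply Hh; lra].
  intros P [eps HP]. exists eps. intros y Hy.
  pose proof (clamp_bounds L y HL). apply HP; [|lra].
  unfold ball in *; simpl in *; unfold AbsRing_ball, abs, minus, plus, opp in *; simpl in *.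
  replace (a + clamp L y + - (a + clamp L s)) with (clamp L y - clamp L s) by ring.
  eapply Rle_lt_trans; [apply Rabs_clamp_sub, HL|exact Hy].
Qed.

Lemma scal_C_R (h : R) (z : C) : scal h (z : C_R_NormedModule) = (RtoC h * z)%C.
Proof.
  destruct z as [u v].
  unfold scal; simpl; unfold prod_scal, scal; simpl; unfold mult; simpl.
  unfold Cmult, RtoC; simpl. f_equal; ring.
Qed.

Lemma condition_C_profile (p1 p2 mu : R) (u0 : tempered_distribution) (f : R -> C) :
  p1 < p2 -> condition_C p1 p2 mu u0 f ->
  exists g g' : R -> C,
    (forall s, Ccontinuous g s) /\ (forall s, Ccontinuous g' s) /\
    (forall s, 0 < s < p2 - p1 -> is_Cderive g s (g' s)) /\
    g 0 <> RtoC 0 /\ g (p2 - p1) = RtoC 0 /\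
    forall p, p1 < p < p2 -> f p = (RtoC (Rpower (p - p1) (mu - 1)) * g (p - p1)%R)%C.
Proof.
  intros Hp [_ [ut [[ut' [Hd Hc]] [H1 [H2 Hf]]]]].
  set (L := p2 - p1).
  assert (HL : 0 < L) by (unfold L; lra).
  assert (EL : p2 = p1 + L) by (unfold L; ring).
  exists (fun s => ut (p1 + clamp L s)), (fun s => ut' (p1 + clamp L s)).
  split; [|split; [|split; [|split; [|split]]]].
  - intros s. apply continuous_clamp_comp; [lra|]. rewrite <- EL. intros p Hpp.
    apply (filterdiff_continuous_aux (U := R_NormedModule) (V := C_R_NormedModule)).
    + eexists. apply Hd, Hpp.
    + intros P HP. apply filter_le_within, HP.
  - intros s. apply continuous_clamp_comp; [lra|]. rewrite <- EL. exact Hc.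
  - intros s Hs. rewrite clamp_id by lra.
    apply (is_derive_ext_loc (V := C_R_NormedModule) (fun s => ut (p1 + s))).
    + assert (He : 0 < Rmin s (L - s)) by (apply Rmin_pos; lra).
      exists (mkposreal _ He). intros y Hy. rewrite clamp_id; [reflexivity|].
      unfold ball in Hy; simpl in Hy; unfold AbsRing_ball, abs, minus, plus, opp in Hy.
      simpl in Hy. pose proof (Rmin_l s (L - s)). pose proof (Rmin_r s (L - s)).
      apply Rabs_def2 in Hy. lra.
    (* At an interior point the segment is a neighbourhood, so the relative derivative is an
       ordinary one. *)
    + assert (D : is_Cderive ut (p1 + s) (ut' (p1 + s))).
      { assert (Hs' : p1 <= p1 + s <= p2) by lra.
        pose proof (filterdiff_ext_lin (U := R_NormedModule) ut _ (fun h : R_NormedModule =>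
          scal h (ut' (p1 + s) : C_R_NormedModule)) (Hd (p1 + s) Hs')
          (fun h => eq_sym (scal_C_R h (ut' (p1 + s))))) as [_ D]. split.
        - apply (is_linear_scal_l (V := C_R_NormedModule)).
        - intros x Hx eps.
          assert (Hx' : is_filter_lim (within (fun q => p1 <= q <= p2) (locally (p1 + s))) x).
          { intros P HP. apply filter_le_within, Hx, HP. }
          assert (He : 0 < Rmin s (L - s)) by (apply Rmin_pos; lra).
          assert (Hin : locally (p1 + s) (fun q => p1 <= q <= p2)).
          { exists (mkposreal _ He). intros y Hy.
            unfold ball in Hy; simpl in Hy; unfold AbsRing_ball, abs, minus, plus, opp in Hy.
            simpl in Hy. pose proof (Rmin_l s (L - s)). pose proof (Rmin_r s (L - s)).
            apply Rabs_def2 in Hy. lra. }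
          specialize (D x Hx' eps). unfold within in D.
          generalize (filter_and _ _ D Hin). apply filter_imp.
          intros q [Hq1 Hq2]. exact (Hq1 Hq2). }
      evar_last.
      * apply (is_Cderive_comp ut (fun s => p1 + s) s _ 1 D).
        auto_derive; [easy|ring].
      * simpl. ring.
  - rewrite clamp_id by lra. now rewrite Rplus_0_r.
  - rewrite clamp_id by lra. now rewrite <- EL.
  - intros p Hpp. rewrite clamp_id by lra. rewrite Hf by exact Hpp.
    now replace (p1 + (p - p1)) with p by ring.
Qed.

(* Integration by parts; the boundary terms vanish because [K 0 = 0] and
   [g L = 0]. *)
Lemma singular_integral_by_parts (p1 L mu : R) (f g g' phi K : R -> C) :
  0 < L ->
  (forall s, Ccontinuous g s) -> (forall s, Ccontinuous g' s) ->
  (forall s, Ccontinuous phi s) ->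
  (forall s, 0 < s < L -> is_Cderive g s (g' s)) -> g L = RtoC 0 ->
  (forall p, p1 < p < p1 + L -> f p = (RtoC (Rpower (p - p1) (mu - 1)) * g (p - p1)%R)%C) ->
  singular_primitive mu phi K ->
  exists W, W 0 = RtoC 0 /\ (forall s, is_Cderive W s (g' s * K s)%C) /\
    is_RInt_gen (V := C_R_NormedModule) (fun p => f p * phi (p - p1)%R)%C
      (at_right p1) (at_left (p1 + L)) (- W L)%C.
Proof.
  intros HL Hg Hg' Hphi Hd HgL Hf [K0 [Kc Kd]].
  destruct (Cprimitive_exists (fun s => g' s * K s)%C) as [W [W0 Wd]].
  { intros s. now apply Ccontinuous_mult. }
  exists W. split; [exact W0|]. split; [exact Wd|].
  (* A primitive of the integrand: [W] removes the term g' K of the product rule. *)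
  set (H := fun p => (g (p - p1)%R * K (p - p1)%R - W (p - p1)%R)%C).
  assert (Sh : forall p, is_derive (fun p => p - p1) p 1).
  { intros p. auto_derive; [easy|ring]. }
  assert (Shc : forall (h : R -> C) p, Ccontinuous h (p - p1) ->
            Ccontinuous (fun p => h (p - p1)) p).
  { intros h p Hh. apply (Ccontinuous_comp h (fun p => p - p1)); [|exact Hh].
    apply (ex_derive_continuous (V := R_NormedModule)). eexists. apply Sh. }
  assert (Hc : forall p, Ccontinuous H p).
  { intros p. unfold H. apply Ccontinuous_minus; [apply Ccontinuous_mult|].
    - now apply Shc.
    - now apply Shc.
    - apply (Shc W). eapply is_Cderive_continuous, Wd. }
  replace (- W L)%C with (H (p1 + L)%R - H p1)%C.
  2: { unfold H. replace (p1 + L - p1) with L by ring. rewrite Rminus_diag.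
       rewrite K0, HgL, W0. ring. }
  apply is_RInt_gen_primitive; [lra|apply Hc|apply Hc| |].
  - intros p Hp. rewrite Hf by exact Hp. unfold H. evar_last.
    + apply is_Cderive_minus; [apply is_Cderive_mult|].
      * exact (is_Cderive_comp g _ p _ 1 (Hd (p - p1) ltac:(lra)) (Sh p)).
      * exact (is_Cderive_comp K _ p _ 1 (Kd (p - p1) ltac:(lra)) (Sh p)).
      * exact (is_Cderive_comp W _ p _ 1 (Wd (p - p1)) (Sh p)).
    + simpl. ring.
  - intros p Hp.
    apply (continuous_ext_loc (U := C_R_NormedModule) _
      (fun p => RtoC (Rpower (p - p1) (mu - 1)) * g (p - p1)%R * phi (p - p1)%R)%C).
    + assert (He : 0 < Rmin (p - p1) (p1 + L - p)) by (apply Rmin_pos; lra).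
      exists (mkposreal _ He). intros y Hy. rewrite Hf; [reflexivity|].
      unfold ball in Hy; simpl in Hy; unfold AbsRing_ball, abs, minus, plus, opp in Hy.
      simpl in Hy. pose proof (Rmin_l (p - p1) (p1 + L - p)).
      pose proof (Rmin_r (p - p1) (p1 + L - p)).
      apply Rabs_def2 in Hy. lra.
    + apply Ccontinuous_mult; [apply Ccontinuous_mult|].
      * apply (Shc (fun s => RtoC (Rpower s (mu - 1)))).
        eapply is_Cderive_continuous, is_Cderive_RtoC, is_derive_Rpower. lra.
      * now apply Shc.
      * now apply Shc.
Qed.

(** The substitution s = r y after completing the square: -t p^2 + 2 t (p1 + r) p = t (p1 + r)^2 - t
    (p - p1 - r)^2. The first term gives the unimodular factor, the weight and ds together give
    r^mu. *)
Definition rescaled_primitive (mu p1 t r : R) (k : R -> C) (s : R) : C :=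
  (expi (t * (p1 + r) ^ 2) * RtoC (Rpower r mu) * k (s / r)%R)%C.

Lemma rescaled_primitive_spec (mu p1 t r : R) (k : R -> C) :
  0 < r -> singular_primitive mu (fun y => expi (quad_phase (t * r ^ 2) y)) k ->
  singular_primitive mu
    (fun s => expi (- (t * (p1 + s) ^ 2) + 2 * t * (p1 + r) * (p1 + s)))
    (rescaled_primitive mu p1 t r k).
Proof.
  intros Hr [K0 [Kc Kd]]. unfold rescaled_primitive. split; [|split].
  - unfold Rdiv. rewrite Rmult_0_l, K0. ring.
  - intros s. apply Ccontinuous_mult; [apply Ccontinuous_const|].
    apply (Ccontinuous_comp k (fun s => s / r)); [|apply Kc].
    apply (ex_derive_continuous (V := R_NormedModule)). auto_derive. easy.
  - intros s Hs.
    assert (Hsr : 0 < s / r) by (apply Rdiv_lt_0_compat; lra).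
    assert (Dr : is_derive (fun s => s / r) s (/ r)) by (auto_derive; [easy|field; lra]).
    evar_last.
    + apply is_Cderive_cmult. exact (is_Cderive_comp k _ s _ (/ r) (Kd _ Hsr) Dr).
    + replace (- (t * (p1 + s) ^ 2) + 2 * t * (p1 + r) * (p1 + s))
        with (t * (p1 + r) ^ 2 + quad_phase (t * r ^ 2) (s / r))
        by (unfold quad_phase; field; lra).
      rewrite expi_plus.
      assert (E : Rpower r mu * (/ r * Rpower (s / r) (mu - 1)) = Rpower s (mu - 1)).
      { replace s with (r * (s / r)) at 2 by (field; lra).
        rewrite <- (Rpower_mult_distr r) by lra. rewrite (Rpower_shift r) by lra.
        unfold Rdiv. ring. }
      rewrite <- E, !RtoC_mult. simpl. ring.
Qed.

(** The bound by [G] alone serves for t <= 1, where [w] may be small. [D] is any uniform bound of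
    the model integral, supplied later, so that [G] and [c] depend on the datum only. *)
Lemma solution_estimates (mu p1 p2 : R) (u0 : tempered_distribution) (f : R -> C) :
  0 < mu < 1 -> p1 < p2 -> condition_C p1 p2 mu u0 f ->
  exists G c, 0 < G /\ 0 < c /\ forall t r k D, 0 < t -> 0 < r ->
  singular_primitive mu (fun y => expi (quad_phase (t * r ^ 2) y)) k ->
  let N := Cmod (schrodinger_solution p1 p2 f t (2 * t * (p1 + r))) in
  N <= G /\
  ((forall z, 0 <= z -> Cmod (k z) <= D) ->
   N <= G * (Rpower r mu * D) /\
   (2 * r <= p2 - p1 ->
    c * (Rpower r mu * Cmod (k 2)) - G * (Rpower r mu * (r * D + / (t * r ^ 2))) <= N)).
Proof.
  intros Hmu Hp HC.
  destruct (condition_C_profile p1 p2 mu u0 f Hp HC)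
    as [g [g' [Hg [Hg' [Hd [Hg0 [HgL Hf]]]]]]].
  set (L := p2 - p1) in *.
  assert (HL : 0 < L) by (unfold L; lra).
  assert (EL : p2 = p1 + L) by (unfold L; ring).
  assert (HM : exists M, 0 < M /\ forall s, 0 <= s <= L -> Cmod (g' s) <= M).
  { destruct (continuity_ab_maj (fun s => Cmod (g' s)) 0 L) as [m [Hm _]]; [lra| |].
    - intros s _. apply continuity_pt_filterlim. apply continuous_Cmod, Hg'.
    - exists (Cmod (g' m) + 1). pose proof (Cmod_ge_0 (g' m)). split; [lra|].
      intros s Hs. specialize (Hm s Hs). simpl in Hm. lra. }
  destruct HM as [M [HM0 HM]].
  assert (Hpi : 0 < / (2 * PI)) by (apply Rinv_0_lt_compat; pose proof PI_RGT_0; lra).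
  set (h := / (2 * PI)) in *.
  set (T := L * (Rpower L mu / mu)).
  assert (HT : 0 < T).
  { apply Rmult_lt_0_compat; [lra|]. apply Rdiv_lt_0_compat; [apply exp_pos|lra]. }
  (* One constant for three estimates: [T] for the first, [L] for the second, 4 and 4 L for the two
     errors of the third. *)
  exists (h * M * (T + L + 4 + 4 * L)), (h * Cmod (g 0)).
  assert (HhM : 0 < h * M) by nra.
  split; [nra|]. split; [apply Rmult_lt_0_compat; [lra|now apply Cmod_gt_0]|].
  intros t r k D Ht Hr Hk N.
  set (K := rescaled_primitive mu p1 t r k).
  assert (HK : singular_primitive mu
    (fun s => expi (- (t * (p1 + s) ^ 2) + 2 * t * (p1 + r) * (p1 + s))) K)
    by (now apply rescaled_primitive_spec).
  assert (HQ : 0 < Rpower r mu) by apply exp_pos.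
  assert (NK : forall s, Cmod (K s) = Rpower r mu * Cmod (k (s / r))).
  { intros s. unfold K, rescaled_primitive.
    rewrite !Cmod_mult, Cmod_expi, Cmod_R, Rabs_pos_eq by lra. ring. }
  set (phi := fun s => expi (- (t * (p1 + s) ^ 2) + 2 * t * (p1 + r) * (p1 + s))) in HK.
  assert (Hphi : forall s, Ccontinuous phi s).
  { intros s. eapply is_Cderive_continuous, is_Cderive_expi. auto_derive; [easy|reflexivity]. }
  rewrite EL in Hf.
  destruct (singular_integral_by_parts p1 L mu f g g' phi K HL Hg Hg' Hphi Hd HgL Hf HK)
    as [W [W0 [Wd WI]]].
  rewrite <- EL in WI.
  assert (EN : N = h * Cmod (W L)).
  { unfold N, schrodinger_solution.
    rewrite (is_RInt_gen_unique (V := C_R_CompleteNormedModule) _ (- W L)%C).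
    - rewrite Cmod_mult, Cmod_R, Cmod_opp, Rabs_pos_eq by (unfold h in *; lra). reflexivity.
    - eapply is_RInt_gen_ext; [|exact WI].
      apply filter_forall. intros ab p _. unfold phi.
      now replace (p1 + (p - p1)) with p by ring. }
  assert (BW : forall B, (forall s, 0 < s < L -> Cmod (K s) <= B) -> Cmod (W L) <= M * L * B).
  { intros B HB. replace (W L) with (W L - W 0)%C by (rewrite W0; ring).
    replace (M * L * B) with (M * B * L - M * B * 0) by ring.
    apply (Cmod_increment_le W (fun s => g' s * K s)%C (fun s => M * B * s)
      (fun _ => M * B)); [lra| | | | |].
    - intros s _. eapply is_Cderive_continuous, Wd.
    - intros s _. apply (ex_derive_continuous (V := R_NormedModule)). auto_derive. easy.
    - intros s _. apply Wd.
    - intros s _. auto_derive; [easy|ring].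
    - intros s Hs. rewrite Cmod_mult. apply Rmult_le_compat; try apply Cmod_ge_0.
      + apply HM; lra.
      + apply HB, Hs. }
  split; [|intros HD; split].
  - rewrite EN. apply Rle_trans with (h * (M * L * (Rpower L mu / mu))); [|unfold T in *; nra].
    apply Rmult_le_compat_l; [lra|]. apply BW. intros s Hs.
    eapply Rle_trans; [apply (singular_primitive_le mu _ K s ltac:(lra) HK); [|lra]|].
    + intros y. unfold phi. rewrite Cmod_expi. lra.
    + apply Rmult_le_compat_r; [apply Rlt_le, Rinv_0_lt_compat; lra|].
      rewrite pos_power_eq by lra. apply Rle_Rpower_l; lra.
  - assert (HD0 : 0 <= D) by (eapply Rle_trans; [apply Cmod_ge_0|apply (HD 0); lra]).
    rewrite EN. apply Rle_trans with (h * (M * L * (Rpower r mu * D))).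
    + apply Rmult_le_compat_l; [lra|]. apply BW. intros s Hs. rewrite NK.
      apply Rmult_le_compat_l; [lra|]. apply HD.
      apply Rlt_le, Rdiv_lt_0_compat; lra.
    + assert (0 <= Rpower r mu * D) by nra.
      replace (h * (M * L * (Rpower r mu * D))) with (h * M * L * (Rpower r mu * D)) by ring.
      apply Rmult_le_compat_r; [assumption|]. apply Rmult_le_compat_l; lra.
  - intros HrL.
    assert (HD0 : 0 <= D) by (eapply Rle_trans; [apply Cmod_ge_0|apply (HD 0); lra]).
    set (w := t * r ^ 2) in *.
    assert (Hw : 0 < w) by (apply Rmult_lt_0_compat; [lra|apply pow_lt; lra]).
    assert (Hiw : 0 < / w) by (apply Rinv_0_lt_compat; lra).
    set (kap := K (2 * r)).
    assert (Nkap : Cmod kap = Rpower r mu * Cmod (k 2)).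
    { unfold kap. rewrite NK. do 3 f_equal. field. lra. }
    (* [V] is a primitive of g' (K - kap), and its increment over [0, L] is W L + kap g 0, since
       [W 0] and [g L] vanish. On [0, 2r] the difference K - kap is only bounded but the interval is
       short; beyond 2r it is O(r^mu / w). *)
    set (V := fun s => (W s - kap * g s)%C).
    assert (Vc : forall s, Ccontinuous V s).
    { intros s. apply Ccontinuous_minus.
      - eapply is_Cderive_continuous, Wd.
      - apply Ccontinuous_mult; [apply Ccontinuous_const|apply Hg]. }
    assert (BV : forall a b B, 0 <= a <= b -> b <= L ->
       (forall s, a < s < b -> Cmod (K s - kap) <= B) ->
       Cmod (V b - V a) <= M * B * b - M * B * a).
    { intros a b B Hab Hb HB.
      apply (Cmod_increment_le V (fun s => g' s * K s - kap * g' s)%C (fun s => M * B * s)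
        (fun _ => M * B)); [lra| | | | |].
      - intros s _. apply Vc.
      - intros s _. apply (ex_derive_continuous (V := R_NormedModule)). auto_derive. easy.
      - intros s Hs. apply is_Cderive_minus; [apply Wd|].
        apply is_Cderive_cmult, Hd. lra.
      - intros s _. auto_derive; [easy|ring].
      - intros s Hs. replace (g' s * K s - kap * g' s)%C with (g' s * (K s - kap))%C by ring.
        rewrite Cmod_mult. apply Rmult_le_compat; try apply Cmod_ge_0.
        + apply HM; lra.
        + apply HB, Hs. }
    pose proof (BV 0 (2 * r) (Rpower r mu * (2 * D)) ltac:(lra) ltac:(lra)) as B1.
    pose proof (BV (2 * r) L (Rpower r mu * (4 * / w)) ltac:(lra) ltac:(lra)) as B2.
    assert (Q1 : Cmod (V (2 * r) - V 0) <=
       M * (Rpower r mu * (2 * D)) * (2 * r) - M * (Rpower r mu * (2 * D)) * 0).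
    { apply B1. intros s Hs. eapply Rle_trans; [apply Cmod_triangle_minus|].
      rewrite NK, Nkap. rewrite <- Rmult_plus_distr_l.
      apply Rmult_le_compat_l; [lra|].
      pose proof (HD (s / r) ltac:(apply Rlt_le, Rdiv_lt_0_compat; lra)).
      pose proof (HD 2 ltac:(lra)). lra. }
    assert (Q2 : Cmod (V L - V (2 * r)) <=
       M * (Rpower r mu * (4 * / w)) * L - M * (Rpower r mu * (4 * / w)) * (2 * r)).
    { apply B2. intros s Hs.
      replace (K s - kap)%C with (expi (t * (p1 + r) ^ 2) * RtoC (Rpower r mu)
         * (k (s / r)%R - k 2))%C.
      2: { unfold kap, K, rescaled_primitive. replace (2 * r / r) with 2 by (field; lra). ring. }
      rewrite !Cmod_mult, Cmod_expi, Cmod_R, Rabs_pos_eq, Rmult_1_l by lra.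
      apply Rmult_le_compat_l; [lra|].
      replace (4 * / w) with (4 / (w * 1)) by (field; lra).
      apply (quad_increment_away mu w k); auto; try lra.
      split; [lra|]. apply Rmult_le_reg_r with r; [lra|].
      unfold Rdiv. rewrite Rmult_assoc, Rinv_l; lra. }
    pose proof (Cmod_triangle (V L - V (2 * r)%R) (V (2 * r)%R - V 0)) as Q3.
    replace (V L - V (2 * r)%R + (V (2 * r)%R - V 0))%C with (W L + kap * g 0)%C in Q3.
    2: { unfold V. rewrite HgL, W0. ring. }
    pose proof (Cmod_triangle_inv (kap * g 0) (W L)) as Q4.
    rewrite (Cplus_comm (kap * g 0)), Cmod_mult, Nkap in Q4.
    rewrite EN.
    set (Q := Rpower r mu) in *. set (gm := Cmod (g 0)) in *. set (n := Cmod (k 2)) in *.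
    assert (R1 : Q * n * gm - M * (Q * (4 * r * D + 4 * L * / w)) <= Cmod (W L)).
    { assert (0 <= M * (Q * (4 * / w)) * (2 * r)).
      { repeat apply Rmult_le_pos; lra. } nra. }
    assert (R2 : h * M * (Q * (4 * r * D + 4 * L * / w))
      <= h * M * (T + L + 4 + 4 * L) * (Q * (r * D + / w))).
    { rewrite (Rmult_assoc (h * M)). apply Rmult_le_compat_l; [lra|].
      replace ((T + L + 4 + 4 * L) * (Q * (r * D + / w)))
        with (Q * ((T + L + 4 + 4 * L) * (r * D + / w))) by ring.
      apply Rmult_le_compat_l; [lra|].
      assert (0 <= r * D) by nra.
      assert (0 <= (T + L + 4 * L) * (r * D)) by (apply Rmult_le_pos; lra).
      assert (0 <= (T + L + 4) * / w) by (apply Rmult_le_pos; lra). lra. }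
    assert (R3 : h * (Q * n * gm - M * (Q * (4 * r * D + 4 * L * / w))) <= h * Cmod (W L))
      by (apply Rmult_le_compat_l; lra).
    lra.
Qed.

(** * Decay rates in time and the theorem *)

Lemma Rpower_mult_sqr (t r a : R) :
  0 < t -> 0 < r -> Rpower (t * r ^ 2) a = Rpower t a * Rpower r (2 * a).
Proof.
  intros Ht Hr. replace (t * r ^ 2) with (t * (r * r)) by ring.
  rewrite <- !Rpower_mult_distr by nra.
  replace (2 * a) with (a + a) by ring. now rewrite Rpower_plus.
Qed.

Lemma Rpower_neg_ge_1 (t a : R) : 0 < t <= 1 -> a <= 0 -> 1 <= Rpower t a.
Proof.
  intros Ht Ha. rewrite <- (Rpower_base_1 a) at 1. apply Rpower_decreasing; lra.
Qed.

(** After w = t r^2 is expanded, both terms carry a negative power of [r], and r >= t^(-eps) in the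
    region. [M] is chosen before [eps]. *)
Lemma solution_upper (mu p1 p2 : R) (u0 : tempered_distribution) (f : R -> C) :
  0 < mu < 1 -> p1 < p2 -> condition_C p1 p2 mu u0 f ->
  exists M, 0 < M /\ forall eps t x, 0 < eps < 1 / 2 -> region eps p1 p2 t x ->
  Cmod (schrodinger_solution p1 p2 f t x)
  <= M * (Rpower t (- mu + eps * mu) + Rpower t (- (1 / 2) + eps * (1 - mu))).
Proof.
  intros Hmu Hp HC.
  destruct (solution_estimates mu p1 p2 u0 f Hmu Hp HC) as [G [c [HG [_ Est]]]].
  destruct (quad_primitive_bound mu Hmu) as [B [HB Bd]].
  exists (G + G * B). split; [nra|]. intros eps t x Heps [Ht [[Hx _] _]].
  set (r := x / (2 * t) - p1).
  assert (Ex : x = 2 * t * (p1 + r)) by (unfold r; field; lra).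
  assert (Hr : Rpower t (- eps) <= r).
  { replace (x / t) with (2 * (p1 + r)) in Hx by (rewrite Ex; field; lra). lra. }
  assert (Hte : 0 < Rpower t (- eps)) by apply exp_pos.
  destruct (quad_primitive_exists mu (t * r ^ 2) ltac:(lra)) as [k Hk].
  (* Only the component free of [D] is extracted, so 0 is a placeholder. *)
  assert (N1 := proj1 (Est t r k 0 Ht ltac:(lra) Hk)).
  rewrite <- Ex in N1.
  assert (P1 : 0 < Rpower t (- mu + eps * mu)) by apply exp_pos.
  assert (P2 : 0 < Rpower t (- (1 / 2) + eps * (1 - mu))) by apply exp_pos.
  assert (HGB : 0 < G * B) by nra.
  (* The region contains times below 1 when p2 - p1 > 1. There w >= 1 may fail, but t^(-mu + eps mu)
     >= 1 and the constant bound suffices. *)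
  destruct (Rle_dec t 1) as [Ht1 | Ht1].
  - assert (1 <= Rpower t (- mu + eps * mu)) by (apply Rpower_neg_ge_1; nra). nra.
  - assert (Hw : 1 <= t * r ^ 2).
    { apply Rle_trans with (t * Rpower t (- eps) ^ 2).
      - replace (t * Rpower t (- eps) ^ 2) with (Rpower t (1 + - eps + - eps)).
        + rewrite <- (Rpower_O t) at 1 by lra. apply Rle_Rpower; lra.
        + rewrite !Rpower_plus, Rpower_1 by lra. ring.
      - apply Rmult_le_compat_l; [lra|]. apply pow_incr. lra. }
    assert (N2 := proj1 (proj2 (Est t r k _ Ht ltac:(lra) Hk)
      (fun z Hz => Bd _ k z Hw Hk Hz))).
    rewrite <- Ex in N2.
    assert (Hpow : forall a, a <= 0 -> Rpower r a <= Rpower t (- eps * a)).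
    { intros a Ha. rewrite <- Rpower_mult. apply Rpower_decreasing; lra. }
    assert (T1 : Rpower r mu * Rpower (t * r ^ 2) (- mu) <= Rpower t (- mu + eps * mu)).
    { rewrite Rpower_mult_sqr by lra.
      replace (Rpower r mu * (Rpower t (- mu) * Rpower r (2 * - mu)))
        with (Rpower t (- mu) * (Rpower r mu * Rpower r (2 * - mu))) by ring.
      rewrite <- Rpower_plus. rewrite (Rpower_plus (- mu)).
      apply Rmult_le_compat_l; [apply Rlt_le, exp_pos|].
      replace (mu + 2 * - mu) with (- mu) by ring.
      replace (eps * mu) with (- eps * - mu) by ring. apply Hpow. lra. }
    assert (T2 : Rpower r mu * Rpower (t * r ^ 2) (- (1 / 2))
                 <= Rpower t (- (1 / 2) + eps * (1 - mu))).
    { rewrite Rpower_mult_sqr by lra.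
      replace (Rpower r mu * (Rpower t (- (1 / 2)) * Rpower r (2 * - (1 / 2))))
        with (Rpower t (- (1 / 2)) * (Rpower r mu * Rpower r (2 * - (1 / 2)))) by ring.
      rewrite <- Rpower_plus. rewrite (Rpower_plus (- (1 / 2))).
      apply Rmult_le_compat_l; [apply Rlt_le, exp_pos|].
      replace (mu + 2 * - (1 / 2)) with (mu - 1) by field.
      replace (eps * (1 - mu)) with (- eps * (mu - 1)) by ring. apply Hpow. lra. }
    eapply Rle_trans; [exact N2|].
    replace (G * (Rpower r mu * (B * (Rpower (t * r ^ 2) (- mu)
               + Rpower (t * r ^ 2) (- (1 / 2))))))
      with (G * B * (Rpower r mu * Rpower (t * r ^ 2) (- mu)
               + Rpower r mu * Rpower (t * r ^ 2) (- (1 / 2)))) by ring.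
    apply Rmult_le_compat; [lra | | lra | lra].
    apply Rplus_le_le_0_compat; apply Rmult_le_pos; apply Rlt_le, exp_pos.
Qed.

(** On the left boundary r = t^(-eps) and w = t^(1 - 2 eps) exactly, so the rate is that of r^mu
    w^(-m), the size of the main term. *)
Lemma solution_lower (mu p1 p2 : R) (u0 : tempered_distribution) (f : R -> C) (eps : R) :
  0 < mu < 1 -> p1 < p2 -> condition_C p1 p2 mu u0 f -> 0 < eps < 1 / 2 ->
  optimal_rate eps p1 (schrodinger_solution p1 p2 f)
    (- eps * mu + (1 - 2 * eps) * - Rmin mu (1 / 2)).
Proof.
  intros Hmu Hp HC Heps. set (m := Rmin mu (1 / 2)).
  assert (Hm : 0 < m /\ m <= mu /\ m <= 1 / 2).
  { split; [apply Rmin_pos; lra|]. split; [apply Rmin_l|apply Rmin_r]. }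
  destruct (solution_estimates mu p1 p2 u0 f Hmu Hp HC) as [G [c [HG [Hc Est]]]].
  destruct (quad_primitive_bound mu Hmu) as [B [HB Bd]].
  destruct (quad_primitive_lower mu Hmu) as [c2 [W [Hc2 [HW Low]]]].
  fold m in Low.
  set (d := c * c2). assert (Hd : 0 < d) by (unfold d; nra).
  assert (HGB : 0 < G * B) by nra.
  (* [T1] and [T3] make each of the two errors at most a quarter of the main term, [T2] gives 2 r <=
     p2 - p1, and [T4] gives w >= W. *)
  destruct (Rpower_small eps (d / (8 * (G * B))) ltac:(lra)) as [T1 [HT1 S1]].
  { apply Rdiv_lt_0_compat; lra. }
  destruct (Rpower_small eps ((p2 - p1) / 2) ltac:(lra) ltac:(lra)) as [T2 [HT2 S2]].
  destruct (Rpower_small ((1 - 2 * eps) / 2) (d / (4 * G)) ltac:(lra)) as [T3 [HT3 S3]].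
  { apply Rdiv_lt_0_compat; lra. }
  destruct (Rpower_small (1 - 2 * eps) (/ W) ltac:(lra)) as [T4 [HT4 S4]].
  { apply Rinv_0_lt_compat; lra. }
  exists (d / 2), (Rmax (Rmax T1 T2) (Rmax T3 T4)).
  pose proof (Rmax_l (Rmax T1 T2) (Rmax T3 T4)). pose proof (Rmax_r (Rmax T1 T2) (Rmax T3 T4)).
  pose proof (Rmax_l T1 T2). pose proof (Rmax_r T1 T2).
  pose proof (Rmax_l T3 T4). pose proof (Rmax_r T3 T4).
  split; [lra|]. split; [lra|]. intros t Ht.
  specialize (S1 t ltac:(lra)). specialize (S2 t ltac:(lra)).
  specialize (S3 t ltac:(lra)). specialize (S4 t ltac:(lra)).
  set (r := Rpower t (- eps)) in *. assert (Hr : 0 < r) by apply exp_pos.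
  set (w := t * r ^ 2).
  assert (Ew : w = Rpower t (1 - 2 * eps)).
  { unfold w, r. replace (1 - 2 * eps) with (1 + - eps + - eps) by ring.
    rewrite !Rpower_plus, Rpower_1 by lra. ring. }
  assert (Hww : W <= w).
  { rewrite <- (Rinv_inv W), <- (Rinv_inv w). apply Rinv_le_contravar.
    - apply Rinv_0_lt_compat. rewrite Ew. apply exp_pos.
    - rewrite Ew, <- Rpower_Ropp. exact S4. }
  destruct (quad_primitive_exists mu w ltac:(lra)) as [k Hk].
  pose proof (Low w k Hww Hk) as L2.
  replace (2 * p1 * t + 2 * Rpower t (1 - eps)) with (2 * t * (p1 + r)).
  2: { unfold r, Rminus. rewrite Rpower_plus, Rpower_1 by lra. ring. }
  set (Q := Rpower w (- m)) in *. assert (HQ : 0 < Q) by apply exp_pos.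
  assert (HD : forall z, 0 <= z -> Cmod (k z) <= 2 * B * Q).
  { intros z Hz. eapply Rle_trans; [apply (Bd w k z); auto; lra|].
    assert (Rpower w (- mu) <= Q) by (apply Rle_Rpower; lra).
    assert (Rpower w (- (1 / 2)) <= Q) by (apply Rle_Rpower; lra). nra. }
  assert (N := proj2 (proj2 (Est t r k _ ltac:(lra) Hr Hk) HD) ltac:(lra)).
  eapply Rle_trans; [|exact N]. fold w.
  assert (Er : Rpower t (- eps * mu + (1 - 2 * eps) * - m) = Rpower r mu * Q).
  { unfold Q. rewrite Ew. unfold r. rewrite !Rpower_mult, <- Rpower_plus. reflexivity. }
  rewrite Er. assert (HP : 0 < Rpower r mu) by apply exp_pos.
  set (P := Rpower r mu) in *.
  (* Split 1/w into two factors w^(-1/2): one is small, the other is at most [Q] because m <=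
     1/2. *)
  assert (Hiw : / w <= d / (4 * G) * Q).
  { replace (/ w) with (Rpower w (- (1 / 2)) * Rpower w (- (1 / 2))).
    2: { rewrite <- Rpower_plus. replace (- (1 / 2) + - (1 / 2)) with (- (1)) by field.
         rewrite Rpower_Ropp, Rpower_1 by lra. reflexivity. }
    apply Rmult_le_compat; try (apply Rlt_le, exp_pos).
    - rewrite Ew, Rpower_mult.
      replace ((1 - 2 * eps) * - (1 / 2)) with (- ((1 - 2 * eps) / 2)) by field. exact S3.
    - apply Rle_Rpower; lra. }
  assert (F1 : c * (c2 * Q) <= c * Cmod (k 2)) by (apply Rmult_le_compat_l; lra).
  assert (F2 : G * (r * (2 * B * Q)) <= d / 4 * Q).
  { replace (G * (r * (2 * B * Q))) with (2 * (G * B) * r * Q) by ring.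
    apply Rmult_le_compat_r; [lra|].
    replace (d / 4) with (2 * (G * B) * (d / (8 * (G * B)))) by (field; lra).
    apply Rmult_le_compat_l; lra. }
  assert (F3 : G * / w <= d / 4 * Q).
  { replace (d / 4 * Q) with (G * (d / (4 * G) * Q)) by (field; lra).
    apply Rmult_le_compat_l; lra. }
  replace (c * (P * Cmod (k 2)) - G * (P * (r * (2 * B * Q) + / w)))
    with (P * (c * Cmod (k 2) - G * (r * (2 * B * Q)) - G * / w)) by ring.
  replace (d / 2 * (P * Q)) with (P * (d / 2 * Q)) by ring.
  apply Rmult_le_compat_l; [lra|]. unfold d in *. lra.
Qed.

Lemma first_term_le_sum_n_m (a : nat -> R) (n : nat) :
  (forall k, 0 <= a k) -> (1 <= n)%nat -> a 1%nat <= sum_n_m a 1 n.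
Proof.
  intros Ha Hn. induction Hn as [|n Hn IH].
  - rewrite sum_n_n. lra.
  - rewrite sum_n_Sm by lia. unfold plus; simpl. specialize (Ha (S n)). lra.
Qed.

(** For mu different from 1/2 the second power of [solution_upper] is entry 1 of the list; the
    further terms of the sum are nonnegative and only enlarge the bound. *)
Lemma upper_bound_on_region_const (eps p1 p2 rate M e : R) (u : R -> R -> C) (n : nat)
    (alpha beta : nat -> R) :
  0 <= M -> (1 <= n)%nat -> - beta 1%nat + eps * alpha 1%nat = e ->
  (forall t x, region eps p1 p2 t x -> Cmod (u t x) <= M * (Rpower t rate + Rpower t e)) ->
  upper_bound_on_region eps p1 p2 u rate n alpha beta (fun _ => M).
Proof.
  intros HM Hn He Hu t x Htx. eapply Rle_trans; [apply Hu, Htx|].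
  rewrite Rmult_plus_distr_l. apply Rplus_le_compat_l. rewrite <- He.
  apply (first_term_le_sum_n_m (fun k => M * Rpower t (- beta k + eps * alpha k))); auto.
  intros k. apply Rmult_le_pos; [lra|apply Rlt_le, exp_pos].
Qed.

Theorem theorem4p7 :
  forall (mu p1 p2 : R) (u0 : tempered_distribution) (Fu0 : R -> C),
  0 < mu < 1 -> p1 < p2 ->
  condition_C p1 p2 mu u0 Fu0 ->
  forall delta : R, 1 / 2 < delta < 1 -> (mu + 1) / 2 <= delta ->
  exists C1 C2 C3 : nat -> R,
    (forall k : nat, 0 <= C1 k /\ 0 <= C2 k /\ 0 <= C3 k) /\
    forall eps : R, 0 < eps < 1 / 2 -> 1 / 2 + eps < delta ->
    let gamma := 2 * delta - 1 in
    let u := schrodinger_solution p1 p2 Fu0 in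
    (1 / 2 < mu ->
       let rate := - (1 / 2) + eps * (1 - mu) in
       upper_bound_on_region eps p1 p2 u rate 9
         (alpha1 mu gamma) (beta1 mu delta) C1 /\
       max_exponent eps 9 (alpha1 mu gamma) (beta1 mu delta) < rate /\
       optimal_rate eps p1 u rate) /\
    (mu = 1 / 2 ->
       let rate := - (1 / 2) + eps / 2 in
       upper_bound_on_region eps p1 p2 u rate 8
         (alpha2 mu gamma) (beta2 delta) C2 /\
       max_exponent eps 8 (alpha2 mu gamma) (beta2 delta) < rate /\
       optimal_rate eps p1 u rate) /\
    (mu < 1 / 2 ->
       let rate := - mu + eps * mu in
       upper_bound_on_region eps p1 p2 u rate 9
         (alpha3 mu gamma) (beta3 delta) C3 /\
       max_exponent eps 9 (alpha3 mu gamma) (beta3 delta) < rate /\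
       optimal_rate eps p1 u rate).
Proof.
  intros mu p1 p2 u0 f Hmu Hp HC delta Hdelta _.
  destruct (solution_upper mu p1 p2 u0 f Hmu Hp HC) as [M [HM Up]].
  (* For mu = 1/2 both powers equal the leading one and merge into it, whence the coefficient 2
     M. *)
  exists (fun _ => M), (fun k => match k with O => 2 * M | _ => 0 end), (fun _ => M).
  split; [intros [|k]; lra|]. intros eps Heps Hde gamma u.
  pose proof (solution_lower mu p1 p2 u0 f eps Hmu Hp HC Heps) as Low. fold u in Low.
  split; [|split]; intros Hc rate; (split; [|split]).
  - apply (upper_bound_on_region_const _ _ _ _ _ (- mu + eps * mu)); [lra|lia| |].
    + reflexivity.
    + intros t x Htx. rewrite Rplus_comm. now apply Up.
  (* The entry -delta + eps (2 - mu) is below the rate exactly when delta > 1/2 + eps. Entry 1 minus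
     the rate is (mu - 1/2) (2 eps - 1). *)
  - unfold max_exponent; cbn -[Rmax]. unfold rate, gamma.
    repeat apply Rmax_lub_lt; nra.
  - rewrite Rmin_right in Low by lra.
    replace rate with (- eps * mu + (1 - 2 * eps) * - (1 / 2)); [exact Low|].
    unfold rate. field.
  - intros t x Htx. specialize (Up eps t x Heps Htx). rewrite Hc in Up.
    replace (- (1 / 2) + eps * (1 / 2)) with rate in Up by (unfold rate; field).
    replace (- (1 / 2) + eps * (1 - 1 / 2)) with rate in Up by (unfold rate; field).
    fold u in Up. eapply Rle_trans; [exact Up|].
    rewrite (sum_n_m_ext_loc _ (fun _ => zero)).
    + rewrite sum_n_m_const_zero. unfold zero; simpl. lra.
    + intros [|k] Hk; [lia|]. unfold zero; simpl. ring.
  - unfold max_exponent; cbn -[Rmax]. unfold rate, gamma. rewrite Hc.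
    repeat apply Rmax_lub_lt; nra.
  - rewrite Rmin_right in Low by lra.
    replace rate with (- eps * mu + (1 - 2 * eps) * - (1 / 2)); [exact Low|].
    unfold rate. rewrite Hc. field.
  - apply (upper_bound_on_region_const _ _ _ _ _ (- (1 / 2) + eps * (1 - mu)));
      [lra|lia| |].
    + reflexivity.
    + intros t x Htx. now apply Up.
  - unfold max_exponent; cbn -[Rmax]. unfold rate, gamma.
    repeat apply Rmax_lub_lt; nra.
  - rewrite Rmin_left in Low by lra.
    replace rate with (- eps * mu + (1 - 2 * eps) * - mu); [exact Low|].
    unfold rate. ring.
Qed.
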